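(* Let $a<b$ be real numbers. Let $f:[a,b]\to\mathbb{R}$ be decreasing and continuously differentiable with $0<\inf_{t\in[a,b]}|f'(t)|\le\sup_{t\in[a,b]}|f'(t)|<\infty$, and let $F(t)=\int_a^t f(x)\,dx$ for $t\in[a,b]$. Let $L:[a,b]\to\mathbb{R}$ be increasing and continuously differentiable with $0<\inf_{t\in[a,b]}L'(t)\le\sup_{t\in[a,b]}L'(t)<\infty$. For each $n$, let $B_n$ be a process on $[L(a),L(b)]$ that is either Brownian motion or Brownian bridge, and let $F_n$ be a cadlag step estimator of $F$ on $[a,b]$ (a random cadlag step function) such that $$\sup_{t\in[a,b]}|F_n(t)-F(t)-n^{-1/2}B_n(L(t))|=O_p(\gamma_n)\quad\text{with}\quad \gamma_n=O\big((n^{-1}\log n)^{2/3}\big).$$ Let $\widehat F_n$ be the least concave majorant of $F_n$ on $[a,b]$. Let $K:\mathbb{R}\to[0,\infty)$ satisfy $\int K(t)\,dt=1$, be supported on $[-1,1]$, and have integrable first and second derivatives. Let $h_n>0$ be a bandwidth, and let $\widetilde f_n$ and $\widehat f_{ns}$ be the boundary-corrected kernel estimators (defined in the context) built from $F_n$ and $\widehat F_n$, respectively, with kernel $K$ and bandwidth $h_n$. Then for $l=0,1$, as $n\to\infty$, $$\sup_{t\in[a,b]}\left|\widehat f_{ns}^{(l)}(t)-\widetilde f_n^{(l)}(t)\right|=O_p\left(h_n^{-(1+l)}n^{-2/3}(\log n)^{2/3}\right),$$ where $\widehat f_{ns}^{(l)}$ and $\widetilde f_n^{(l)}$ denote $l$-th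 derivatives (the $0$-th derivative being the function itself).
   Context: The least concave majorant of a bounded function on an interval is the smallest concave function on that interval lying above it. ''Brownian motion or Brownian bridge on $[L(a),L(b)]$'' means the restriction to $[L(a),L(b)]$ of a standard Brownian motion $W$ with $W(0)=0$ (two-sided if needed), or of a standard Brownian bridge on $[0,1]$ (in which case $[L(a),L(b)]\subset[0,1]$). $(\gamma_n)$ is a deterministic sequence of positive numbers; $F_n$ and $B_n$ live on a common probability space. Boundary-corrected kernel estimator: for $G_n\in\{F_n,\widehat F_n\}$ and $h_n>0$ (with $2h_n\le b-a$), the estimator $g_n$ built from $G_n$ is defined on $[a+h_n,b-h_n]$ by $$g_n(t)=\frac1{h_n}\int_{\mathbb{R}} K\Big(\frac{t-x}{h_n}\Big)\,dG_n(x),$$ where $dG_n$ is the (signed) Stieltjes measure of $G_n$ on $[a,b]$, and is extended linearly at the boundaries by $$g_n(t)=g_n(a+h_n)+g_n'(a+h_n)(t-a-h_n),\quad t\in[a,a+h_n],$$ $$g_n(t)=g_n(b-h_n)+g_n'(b-h_n)(t-b+h_n),\quad t\in[b-h_n,b].$$ Then $\widetilde f_n$ is $g_n$ for $G_n=F_n$ and $\widehat f_{ns}$ is $g_n$ for $G_n=\widehat F_n$. $O_p$ denotes boundedness in probability as $n\to\infty$. *)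

(* Defs.v *)
From HB Require Import structures.
From mathcomp Require Export all_boot all_order all_algebra.
From mathcomp Require Export all_classical all_reals all_analysis.
Export Order.TTheory GRing.Theory Num.Theory numFieldNormedType.Exports.

Global Open Scope classical_set_scope.
Global Open Scope ring_scope.

(* A function on [a, b] is a total function of which only the restriction to
   [a, b] matters; hence limits of difference quotients are taken inside
   [a, b], i.e. they are one-sided at a and b. *)
Definition is_derivative_on {R : realType} (a b : R) (f df : R -> R) : Prop :=
  forall t, t \in `[a, b] ->
    (x - t)^-1 * (f x - f t) @[x --> within `[a, b] t^'] --> df t.

Definition is_C1_on {R : realType} (a b : R) (f df : R -> R) : Prop :=
  is_derivative_on a b f df /\ {within `[a, b], continuous df}.

Definition sup_on {R : realType} (a b : R) (f : R -> R) : \bar R :=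
  ereal_sup [set (f t)%:E | t in `[a, b]].

Definition inf_on {R : realType} (a b : R) (f : R -> R) : \bar R :=
  ereal_inf [set (f t)%:E | t in `[a, b]].

(* Constant on each [t_i, t_(i+1)[ for a finite subdivision
   a = t_0 < ... < t_k = b; the value at b is free. *)
Definition cadlag_step_on {R : realType} (a b : R) (G : R -> R) : Prop :=
  exists2 s : seq R, itv_partition a b s &
    forall i, (i < size s)%N ->
      forall x, x \in `[nth b (a :: s) i, nth b (a :: s) i.+1[ ->
        G x = G (nth b (a :: s) i).

Definition concave_on {R : realType} (a b : R) (g : R -> R) : Prop :=
  convex_function (`[a, b] : set (convex_lmodType R^o)) (fun x => - g x).

Definition majorant_on {R : realType} (a b : R) (G g : R -> R) : Prop :=
  forall x, x \in `[a, b] -> G x <= g x.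

Definition is_least_concave_majorant {R : realType} (a b : R) (G H : R -> R)
    : Prop :=
  [/\ concave_on a b H, majorant_on a b G H &
    forall g, concave_on a b g -> majorant_on a b G g -> majorant_on a b H g].

(* Integral of phi against the signed Stieltjes measure of G on [a, b], for G
   right-continuous of bounded variation on [a, b].  Such a G is a difference
   G1 - G2 of cumulative functions, the signed measure is the difference of the
   corresponding Lebesgue-Stieltjes measures, and for bounded measurable phi
   the value does not depend on the choice of G1, G2.  The convention is
   G(a-) = G(a), so there is no atom at a; an atom at a would be harmless below
   because it is weighted by K(u) and K'(u) with u >= 1, which vanish. *)
Definition stieltjes_integral {R : realType} (a b : R) (G phi : R -> R) : R :=
  get [set v : R | exists G1 G2 : cumulative R R,
    (forall x, x \in `[a, b] -> G x = G1 x - G2 x) /\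
    v = \int[lebesgue_stieltjes_measure G1]_(x in `]a, b]) phi x -
        \int[lebesgue_stieltjes_measure G2]_(x in `]a, b]) phi x].

Definition kernel_estimator {R : realType} (a b : R) (K : R -> R) (h : R)
    (G : R -> R) (t : R) : R :=
  h^-1 * stieltjes_integral a b G (fun x => K ((t - x) / h)).

(* The derivative of the estimator at a + h and b - h is that of the kernel
   formula, which makes sense (and is differentiable for a differentiable
   kernel) at every t, also when 2 h = b - a.  Outside [a, b] the linear pieces
   are prolonged, so that the two-sided derivatives of this function at a and b
   are the one-sided derivatives of its restriction to [a, b]. *)
Definition corrected_kernel_estimator {R : realType} (a b : R) (K : R -> R)
    (h : R) (G : R -> R) (t : R) : R :=
  let g := kernel_estimator a b K h G in
  if t < a + h then g (a + h) + derive1 g (a + h) * (t - a - h)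
  else if b - h < t then g (b - h) + derive1 g (b - h) * (t - b + h)
  else g t.

(* Law N(m, s^2), the Dirac mass at m if s = 0 (the library's normal_prob m 0
   is a uniform law). *)
Definition has_normal_law {R : realType} {d : measure_display}
    {T : measurableType d} (P : probability T R) (X : T -> R) (m s : R) : Prop :=
  forall A : set R, measurable A ->
    P (X @^-1` A) = if s == 0 then \d_m A else normal_prob m s A.

(* The product rule for subfamilies is obtained by taking some A i = setT. *)
Definition mutually_independent {R : realType} {d : measure_display}
    {T : measurableType d} (P : probability T R) {k : nat}
    (X : 'I_k -> T -> R) : Prop :=
  forall A : 'I_k -> set R, (forall i, measurable (A i)) ->
    P (\bigcap_i (X i @^-1` A i)) = (\prod_(i < k) P (X i @^-1` A i))%E.

(* Time set J, typically [0, +oo[ or, for the two-sided motion, the whole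
   line; W is irrelevant outside J. *)
Definition standard_brownian_motion {R : realType} {d : measure_display}
    {T : measurableType d} (P : probability T R) (J : set R)
    (W : R -> {RV P >-> R}) : Prop :=
  [/\ {ae P, forall w, W 0 w = 0},
      {ae P, forall w, {within J, continuous (fun t => W t w)}},
      forall s t, J s -> J t -> s <= t ->
        has_normal_law P (W t \- W s) 0 (Num.sqrt (t - s)) &
      forall (k : nat) (t : nat -> R),
        (forall i, (i <= k)%N -> J (t i)) ->
        (forall i, (i < k)%N -> t i <= t i.+1) ->
        mutually_independent P (fun i : 'I_k => W (t i.+1) \- W (t i))].

Definition gaussian_process {R : realType} {d : measure_display}
    {T : measurableType d} (P : probability T R) (J : set R)
    (X : R -> {RV P >-> R}) : Prop :=
  forall (k : nat) (t c : 'I_k -> R), (forall i, J (t i)) ->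
    exists m s : R, 0 <= s /\
      has_normal_law P (fun w => \sum_(i < k) c i * X (t i) w) m s.

Definition standard_brownian_bridge {R : realType} {d : measure_display}
    {T : measurableType d} (P : probability T R) (X : R -> {RV P >-> R}) : Prop :=
  [/\ gaussian_process P `[0, 1]%classic X,
      {ae P, forall w, {within `[0, 1]%classic, continuous (fun t : R => X t w)}},
      forall t : R, t \in `[0, 1] -> ('E_P[X t] = 0)%E &
      forall s t : R, s \in `[0, 1] -> t \in `[0, 1] ->
        covariance P (X s) (X t) = (Num.min s t - s * t)%:E].

Definition brownian_motion_on {R : realType} {d : measure_display}
    {T : measurableType d} (P : probability T R) (u v : R)
    (B : R -> T -> R) : Prop :=
  exists (J : set R) (W : R -> {RV P >-> R}),
    [/\ is_interval J, J 0, `[u, v] `<=` J, standard_brownian_motion P J W &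
        forall t w, t \in `[u, v] -> B t w = W t w].

Definition brownian_bridge_on {R : realType} {d : measure_display}
    {T : measurableType d} (P : probability T R) (u v : R)
    (B : R -> T -> R) : Prop :=
  `[u, v] `<=` `[0, 1] /\
  exists X : R -> {RV P >-> R}, standard_brownian_bridge P X /\
    forall t w, t \in `[u, v] -> B t w = X t w.

(* X_n = O_p(r_n).  Stated with a measurable exceptional event, i.e. with outer
   probability, since the suprema it is applied to are uncountable. *)
Definition bounded_in_probability {R : realType} {d : measure_display}
    {T : measurableType d} (P : probability T R) (X : nat -> T -> \bar R)
    (r : nat -> R) : Prop :=
  forall e : R, 0 < e -> exists M : R, \forall n \near \oo,
    exists A : set T, [/\ measurable A, (P A <= e%:E)%E &
      forall w, ~ A w -> (`|X n w| <= (M * r n)%:E)%E].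

(* Main.v *)
From HB Require Import structures.
Require Import Defs.
From mathcomp Require Import ring lra zify.
From mathcomp Require Import measurable_realfun.
Set Implicit Arguments.
Unset Strict Implicit.
Unset Printing Implicit Defensive.

(** Write [g_G] for the corrected estimator built from [G].  Inside [[a + h, b - h]]
    the difference of [g_G] and [g_H] is an integral of [K ((t - x) / h)] against
    [d(G - H)].  The kernel vanishes outside [[-1, 1]] and has bounded variation since
    [K'] is integrable, so integration by parts bounds that integral by the sup distance
    of [G] and [H] times the variation of [K]; [K'] is treated in the same way since
    [K''] is integrable.  The linear pieces at the boundary inherit both bounds
    ([corrected_estimator_diff_le], [kernel_smoothing_bound]).  It remains to see that
    the majorant of [F_n] is uniformly at distance [O_p ((ln n / n)^(2/3))] from [F_n].

    As [f'] stays away from zero, [F] is strongly concave: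
    [F s <= F t + f t (s - t) - c (s - t)^2].  By Levy's modulus of continuity the noise
    [n^(-1/2) (B_n (L s) - B_n (L t))] is of order [(|s - t| ln n / n)^(1/2)], which by
    Young's inequality is at most [c (s - t)^2 + C (ln n / n)^(2/3)]: the two sides
    balance at lags of order [(ln n / n)^(1/3)].  The quadratic terms cancel, so [F_n]
    lies below the line of slope [f t] through the point at height [F_n t + Delta] above
    [t], with [Delta] of the order claimed.  Lines are concave, hence the least concave
    majorant lies below that line as well, and at [t] this reads
    [Fhat_n t <= F_n t + Delta] ([lcm_diff_le], [lcm_estimator_rate]).

    Levy's modulus only needs sub-Gaussian increments and continuous paths: a union bound
    over the dyadic grid ([levy_event]) and a chaining argument ([chaining]).  For
    Brownian motion the tails of the increments are given.  An increment of the bridge is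
    Gaussian with a second moment at most the lag, which controls its mean and its
    variance ([gaussian_sub_gaussian]).  Running the process at the clock [L] rescales
    the lags by a bounded factor only.

    The Stieltjes integrals make sense because a cadlag step function and its least
    concave majorant are differences of nondecreasing right-continuous functions, and the
    integral of a continuous function is a limit of Riemann-Stieltjes sums, which do not
    see which decomposition is used ([stieltjes_integralE]). *)

(** * Differentiable functions on a segment *)

(** The points [z] between [x] and [y] with [u z <= u x] have a supremum with the same
    property, by the behaviour of [u] on its left; by the behaviour on its right it cannot
    be less than [y].  This does the work of the mean value theorem for derivatives that
    are one-sided at the end points, and for functions of which only the size of the
    increments is known. *)
Lemma locally_nonincreasing {R : realType} (p q : R) (u : R -> R) :
  (forall x, x \in `[p, q] -> exists2 d : R, 0 < d &
    forall y, y \in `[p, q] -> `|y - x| < d ->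
      (x <= y -> u y <= u x) /\ (y <= x -> u x <= u y)) ->
  {in `[p, q] &, {homo u : x y /~ x <= y}}.
Proof.
move=> loc y x ypq xpq xy.
have px : p <= x by move: xpq; rewrite in_itv => /andP[].
have yq : y <= q by move: ypq; rewrite in_itv => /andP[].
pose S : set R := [set z | x <= z <= y /\ u z <= u x].
have Sx : S x by rewrite /S /= lexx xy.
have supS : has_sup S by split; [exists x|exists y => z [/andP[]]].
have xs : x <= sup S by apply: ub_le_sup => //; exact: supS.2.
have sy : sup S <= y by apply: ge_sup => [|z [/andP[]]//]; exists x.
have spq : sup S \in `[p, q] by rewrite in_itv/= (le_trans px)// (le_trans sy).
have [d d0 loc_s] := loc _ spq.
have Ss : S (sup S).
  have [z [/andP[xz zy] uz] sz] := sup_adherent d0 supS.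
  have zs : z <= sup S by apply: ub_le_sup; [exact: supS.2|rewrite /S /= xz zy].
  split; first by rewrite xs.
  apply: le_trans uz; apply: (loc_s z _ _).2 => //.
    by rewrite in_itv/= (le_trans px)// (le_trans zy).
  by rewrite ler0_norm ?subr_le0// opprB ltrBlDr -ltrBlDl.
have [<-|sy'] := eqVneq (sup S) y; first exact: Ss.2.
have {}sy' : sup S < y by rewrite lt_neqAle sy'.
pose z := Num.min y (sup S + d / 2).
have sz : sup S < z by rewrite lt_min sy' ltrDl divr_gt0.
have : S z.
  have zy : z <= y by rewrite ge_min lexx.
  split; first by rewrite zy (le_trans xs)// ltW.
  apply: le_trans Ss.2; apply: (loc_s z _ _).1; last exact: ltW.
    by rewrite in_itv/= (le_trans px (le_trans xs (ltW sz))) (le_trans zy).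
  rewrite gtr0_norm ?subr_gt0// ltrBlDl (@le_lt_trans _ _ (sup S + d / 2))//.
    by rewrite ge_min lexx orbT.
  by rewrite ltrD2l ltr_pdivrMr// ltr_pMr// ltr1n.
move=> /(ub_le_sup supS.2); rewrite leNgt => /negP; case.
exact: sz.
Qed.

Lemma linear_approx_within {R : realType} (a b : R) (f df : R -> R) (t e : R) :
  is_derivative_on a b f df -> t \in `[a, b] -> 0 < e -> exists2 d : R, 0 < d &
    forall x, x \in `[a, b] -> `|x - t| < d ->
      `|f x - f t - df t * (x - t)| <= e * `|x - t|.
Proof.
move=> fdf tab e0; have /cvgrPdist_lt/(_ _ e0) := fdf t tab.
move=> /nbhs_ballP[d d0 H].
exists d => // x xab xtd.
have [->|xt] := eqVneq x t; first by rewrite !subrr mulr0 subr0 normr0 mulr0.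
have := H x _ xt xab; rewrite /ball /= distrC => /(_ xtd).
have xt0 : x - t != 0 by rewrite subr_eq0.
move=> /ltW; rewrite -(ler_pM2r (_ : 0 < `|x - t|)) ?normr_gt0// -normrM.
by rewrite mulrBl mulrAC mulVf// mul1r distrC.
Qed.

(** In this form of differentiability, functions can be glued at a point and the
    remainder can be estimated under an integral. *)
Lemma is_derive_linear_approx {R : realType} (f : R -> R) (t l : R) :
  is_derive t (1 : R) f l <-> forall e, 0 < e -> exists2 d : R, 0 < d &
    forall x, `|x - t| < d -> `|f x - f t - l * (x - t)| <= e * `|x - t|.
Proof.
split=> [[fd <-] e e0|H].
  have /cvgrPdist_lt/(_ _ e0) := fd.
  move=> /nbhs_ballP[d d0 H'].
  exists d => // x xtd.
  have [->|xt] := eqVneq x t; first by rewrite !subrr mulr0 subr0 normr0 mulr0.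
  have xt0 : x - t != 0 by rewrite subr_eq0.
  have := H' (x - t); rewrite /ball/= sub0r normrN => /(_ xtd xt0).
  move=> /ltW; rewrite -(ler_pM2r (_ : 0 < `|x - t|)) ?normr_gt0// -normrM.
  rewrite /shift/= [_%:A]mulr1 subrK mulrBl -/('D_1 f t).
  by rewrite -[_ *: _]/(_ * _) mulrAC mulVf// mul1r -normrN opprB.
have C : h^-1 *: ((f \o shift t) (h *: (1 : R)) - f t) @[h --> 0^'] --> l.
  apply/cvgrPdist_le => e e0; have [d d0 H'] := H e e0.
  apply/nbhs_ballP; exists d => // x; rewrite /ball/= sub0r normrN => xd x0.
  have := H' (x + t); rewrite addrK => /(_ xd).
  rewrite /shift/= [_%:A]mulr1 -[_ *: _]/(_ * _).
  rewrite -[leLHS]normrN opprB => xl.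
  rewrite -(ler_pM2r (_ : 0 < `|x|)) ?normr_gt0// -normrM mulrBl.
  by rewrite [x^-1 * _ * x]mulrAC mulVf// mul1r.
split; first by apply/cvg_ex; exists l.
exact: cvg_lim.
Qed.

(** Monotonicity decides the sign of [df], as a positive derivative would make [f]
    increase nearby; half of [c] pays for the remainder of the linear approximation. *)
Lemma strongly_decreasing {R : realType} (a b c : R) (f df : R -> R) :
  a < b -> is_derivative_on a b f df ->
  {in `[a, b] &, {homo f : x y /~ x <= y}} ->
  (forall t, t \in `[a, b] -> c <= `|df t|) -> 0 < c ->
  forall x y, x \in `[a, b] -> y \in `[a, b] -> x <= y ->
    c / 2 * (y - x) <= f x - f y.
Proof.
move=> ab fdf fdecr dfc c0.
have c2 : 0 < c / 2 by rewrite divr_gt0.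
have df0 t : t \in `[a, b] -> df t <= - c.
  move=> tab; have := dfc t tab.
  have [df0|df0] := leP (df t) 0; first by rewrite ler0_norm// lerNr.
  move=> cdf; have [d d0 H] := linear_approx_within fdf tab c2.
  have [y [yab yt yd]] : exists y, [/\ y \in `[a, b], y != t & `|y - t| < d].
    move: tab; rewrite in_itv/= => /andP[at_ tb].
    have [tb'|bt] := ltP t b.
      have y1 : t < Num.min b (t + d / 2) by rewrite lt_min tb' ltrDl divr_gt0.
      exists (Num.min b (t + d / 2)); split.
      - by rewrite in_itv/= ge_min lexx andbT (le_trans at_ (ltW y1)).
      - by rewrite gt_eqF.
      rewrite gtr0_norm ?subr_gt0// ltrBlDl.
      rewrite (@le_lt_trans _ _ (t + d / 2)) ?ge_min ?lexx ?orbT//.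
      by rewrite ltrD2l ltr_pdivrMr// ltr_pMr// ltr1n.
    have at' : a < t by rewrite (lt_le_trans ab).
    have y1 : Num.max a (t - d / 2) < t.
      by rewrite gt_max at'/= ltrBlDr ltrDl divr_gt0.
    exists (Num.max a (t - d / 2)); split.
    - by rewrite in_itv/= le_max lexx/= (le_trans (ltW y1) tb).
    - by rewrite lt_eqF.
    rewrite ltr0_norm ?subr_lt0// opprB ltrBlDr -ltrBlDl.
    rewrite (@lt_le_trans _ _ (t - d / 2)) ?le_max ?lexx ?orbT//.
    by rewrite ltrD2l ltrN2 ltr_pdivrMr// ltr_pMr// ltr1n.
  have := H y yab yd; rewrite ler_norml => /andP[H1 H2].
  have [ty|yt'] := leP t y.
    have ty' : t < y by rewrite lt_neqAle eq_sym yt.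
    have := fdecr y t yab tab ty.
    rewrite (gtr0_norm df0) in cdf; rewrite gtr0_norm ?subr_gt0// in H1.
    by move: (subr_gt0 t y); rewrite ty' => D; nra.
  have := fdecr t y tab yab (ltW yt').
  rewrite (gtr0_norm df0) in cdf; rewrite ltr0_norm ?subr_lt0// in H2.
  by move: (subr_gt0 y t); rewrite yt' => D; nra.
suff H : {in `[a, b] &, {homo (fun x => f x + c / 2 * x) : x y /~ x <= y}}.
  by move=> x y xab yab xy; have := H y x yab xab xy; lra.
apply: locally_nonincreasing => x xab.
have [d d0 H] := linear_approx_within fdf xab c2.
exists d => // y yab /H -/(_ yab); have := df0 x xab.
rewrite ler_norml => dfx /andP[H1 H2]; split => xy.
  by rewrite ger0_norm ?subr_ge0// in H2; move: (subr_ge0 x y); rewrite xy => D; nra.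
by rewrite ler0_norm ?subr_le0// in H1; move: (subr_ge0 y x); rewrite xy => D; nra.
Qed.

(** The extra [1] pays for the remainder of the linear approximation. *)
Lemma lipschitz_of_derivative_le {R : realType} (a b M : R) (f df : R -> R) :
  is_derivative_on a b f df -> (forall t, t \in `[a, b] -> df t <= M) ->
  forall x y, x \in `[a, b] -> y \in `[a, b] -> x <= y ->
    f y - f x <= (M + 1) * (y - x).
Proof.
move=> fdf dfM.
suff H : {in `[a, b] &, {homo (fun x => f x - (M + 1) * x) : x y /~ x <= y}}.
  by move=> x y xab yab xy; have := H y x yab xab xy; lra.
apply: locally_nonincreasing => x xab.
have [d d0 H] := linear_approx_within fdf xab ltr01.
exists d => // y yab /H -/(_ yab); have := dfM x xab.
rewrite ler_norml => dfx /andP[H1 H2]; split => xy.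
  by rewrite ger0_norm ?subr_ge0// in H2; move: (subr_ge0 x y); rewrite xy => D; nra.
by rewrite ler0_norm ?subr_le0// in H1; move: (subr_ge0 y x); rewrite xy => D; nra.
Qed.

Lemma is_derivative_on_continuous {R : realType} (a b : R) (f df : R -> R) :
  is_derivative_on a b f df -> {within `[a, b], continuous f}.
Proof.
move=> fdf; apply/subspace_continuousP => t tab.
have [d d0 H] := linear_approx_within fdf tab ltr01.
apply/cvgrPdist_le => e e0.
have D0 : 0 < `|df t| + 1 by rewrite ltr_wpDl.
have m0 : 0 < Num.min d (e / (`|df t| + 1)) by rewrite lt_min d0 divr_gt0.
apply/nbhs_ballP; exists (Num.min d (e / (`|df t| + 1))) => //=.
move=> x; rewrite /ball/= distrC => xt xab.
have xd : `|x - t| < d by rewrite (lt_le_trans xt)// ge_min lexx.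
have xe : `|x - t| <= e / (`|df t| + 1).
  by rewrite (le_trans (ltW xt))// ge_min lexx orbT.
have := H x xab xd; rewrite mul1r => H1.
have := ler_normD (f x - f t - df t * (x - t)) (df t * (x - t)).
rewrite subrK normrM => H2; rewrite ler_pdivlMr// in xe.
rewrite distrC (_ : `|_| = `|f x - f t|)//; nra.
Qed.

Lemma integral_decreasing_bounds {R : realType} (a b : R) (f F : R -> R) :
  {within `[a, b], continuous f} ->
  {in `[a, b] &, {homo f : x y /~ x <= y}} ->
  (forall t, t \in `[a, b] -> F t = \int[lebesgue_measure]_(x in `[a, t]) f x) ->
  forall x y, x \in `[a, b] -> y \in `[a, b] -> x <= y ->
    f y * (y - x) <= F y - F x <= f x * (y - x).
Proof.
move=> fc fdecr FE x y xab yab xy.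
have := xab; have := yab; rewrite !in_itv/= => /andP[ay yb] /andP[ax xb].
have intf (A : set R) : measurable A -> A `<=` `[a, b] ->
    lebesgue_measure.-integrable A (EFin \o f).
  move=> mA Aab; apply: (@integrableS _ _ _ lebesgue_measure `[a, b]%classic) => //.
  by apply: continuous_compact_integrable => //; exact: segment_compact.
rewrite !FE// Rintegral_itvB ?bnd_simp//; last first.
  by apply: intf => // z /=; rewrite !in_itv/= => /andP[-> /le_trans]; apply.
have sub : `]x, y]%classic `<=` `[a, b]%classic.
  move=> z /=; rewrite !in_itv/= => /andP[xz zy].
  by rewrite (le_trans ax (ltW xz)) (le_trans zy).
have ci (r : R) : lebesgue_measure.-integrable `]x, y]%classic (EFin \o cst r).
  apply: (@integrableS _ _ _ lebesgue_measure `[x, y]%classic) => //.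
    exact: subset_itv_oc_cc.
  apply: continuous_compact_integrable => //; first exact: segment_compact.
  by apply: continuous_subspaceT => ?; exact: cst_continuous.
have cE (r : R) : \int[lebesgue_measure]_(z in `]x, y]) r = r * (y - x).
  rewrite Rintegral_cst//= lebesgue_measure_itv/= lte_fin.
  have [xy'|] := ltP x y; first by [].
  by move=> yx; rewrite (@le_anti _ _ x y) ?subrr ?mulr0// xy yx.
rewrite -!cE; apply/andP; split; apply: le_Rintegral; rewrite ?inE//;
  try exact: intf; try exact: ci.
  move=> z zxy; apply: fdecr => //; first exact: sub.
  by move: zxy; rewrite /= in_itv/= => /andP[].
move=> z zxy; apply: fdecr => //; first exact: sub.
by move: zxy; rewrite /= in_itv/= => /andP[/ltW].
Qed.

(** Bound [f] by its extreme values on each half of the interval between [s] and [t].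
    The half next to [t] gives the slope [f t]; on the other half the slope is off by
    [c * `|s - t| / 2] over a length [`|s - t| / 2]. *)
Lemma strongly_concave_primitive {R : realType} (a b c : R) (f F : R -> R) :
  (forall x y, x \in `[a, b] -> y \in `[a, b] -> x <= y ->
    c * (y - x) <= f x - f y) ->
  (forall x y, x \in `[a, b] -> y \in `[a, b] -> x <= y ->
    f y * (y - x) <= F y - F x <= f x * (y - x)) ->
  forall s t, s \in `[a, b] -> t \in `[a, b] ->
    F s - F t <= f t * (s - t) - c / 4 * (s - t) ^+ 2.
Proof.
move=> fc Ff s t sab tab.
have mab : (s + t) / 2 \in `[a, b].
  by move: sab tab; rewrite !in_itv/= => /andP[? ?] /andP[? ?]; apply/andP; split; lra.
have [st|/ltW ts] := leP s t.
  have s1 : s <= (s + t) / 2 by lra.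
  have s2 : (s + t) / 2 <= t by lra.
  have /andP[H1 _] := Ff _ _ sab mab s1.
  have /andP[H2 _] := Ff _ _ mab tab s2.
  have := fc _ _ mab tab s2; nra.
have s1 : t <= (s + t) / 2 by lra.
have s2 : (s + t) / 2 <= s by lra.
have /andP[_ H1] := Ff _ _ tab mab s1.
have /andP[_ H2] := Ff _ _ mab sab s2.
have := fc _ _ tab mab s1; nra.
Qed.

Local Notation leb := lebesgue_measure.

(** As [df] is merely integrable, the primitive of [`|df|] need not dominate the increments
    of [f] near a given point.  Let [E k] be the set where [`|df x|] is between [k] and
    [k + 1] and cover it by an open set [U k] of nearly the same measure.  The function
    [g], equal to the sum of [(k + 2) \1_(U k)], is still integrable, and it exceeds
    [`|df x| + 1] on a whole neighbourhood of [x].  Its primitive [G] therefore dominates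
    the increments of [f] near each point, hence everywhere by [locally_nonincreasing]. *)
Lemma monotone_domination {R : realType} (p q : R) (f df : R -> R) :
  (forall x, x \in `[p, q] -> is_derive x (1 : R) f (df x)) ->
  lebesgue_measure.-integrable `[p, q] (EFin \o df) ->
  exists G : R -> R, forall x y, x \in `[p, q] -> y \in `[p, q] -> x <= y ->
    `|f y - f x| <= G y - G x.
Proof.
move=> fdf intdf; set D := `[p, q]%classic.
have mD : measurable D by exact: measurable_itv.
have muD : (leb D < +oo)%E.
  by rewrite /D lebesgue_measure_itv/=; case: ifP => // _; rewrite -EFinD ltry.
pose g0 (x : R) : R := `|df x| + 2.
have mdf : measurable_fun D df by apply/measurable_EFinP; exact: (measurable_int leb intdf).
have mndf : measurable_fun D (fun x => `|df x|) by exact: measurableT_comp.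
have intg0 : leb.-integrable D (EFin \o g0).
  rewrite (_ : EFin \o g0 = (abse \o (EFin \o df)) \+ cst 2%:E)%E//.
  apply: (@integrableD _ _ _ leb D mD (abse \o (EFin \o df)) (cst 2%:E)).
    exact: integrable_abse.
  apply: (@continuous_compact_integrable R (cst 2)); first exact: segment_compact.
  by apply: continuous_subspaceT => ?; exact: cst_continuous.
pose E k := D `&` (fun x => `|df x|) @^-1` `[k%:R, k.+1%:R[%classic.
have mE k : measurable (E k) by exact: mndf.
have ED k : E k `<=` D by move=> x [].
have muE k : (leb (E k) < +oo)%E.
  by apply: le_lt_trans muD; apply: le_measure; rewrite ?inE//; exact: mE.
(* the excess of [U k] is weighted by [k + 2], and must still sum to one *)
pose r (k : nat) : R := (2 ^ k.+1)%:R^-1 / k.+2%:R.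
have r0 k : 0 < r k by rewrite divr_gt0 ?invr_gt0// ltr0n expn_gt0.
have /choice[U HU] k : exists U : set R, [/\ open U, E k `<=` U &
    (leb (U `\` E k) < (r k)%:E)%E].
  exact: (lebesgue_regularity_outer (mE k) (muE k) (r0 k)).
have oU k : open (U k) by case: (HU k).
have mU k : measurable (U k) by exact: open_measurable (oU k).
have EU k : E k `<=` U k by case: (HU k).
have mUE k : measurable (U k `\` E k) by exact: measurableD.
have mUI k : measurable (U k `&` D) by exact: measurableI.
have muU k : (k.+2%:R%:E * leb (U k `&` D) <=
    k.+2%:R%:E * leb (E k) + (1 / (2 ^ k.+1)%:R)%:E)%E.
  have : (leb (U k `&` D) <= leb (E k) + (r k)%:E)%E.
    rewrite (@le_trans _ _ (leb (E k `|` (U k `\` E k))))//.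
      apply: le_measure; rewrite ?inE; [exact: mUI|by apply: measurableU; [exact: mE|exact: mUE]|].
      move=> x [Ux _]; have [Ex|Ex] := pselect (E k x); [by left|by right].
    rewrite measureU; [|exact: mE|exact: mUE|]; last by rewrite setDE setICA setICr setI0.
    by rewrite leeD2l// ltW//; case: (HU k).
  move=> H; apply: (@le_trans _ _ (k.+2%:R%:E * (leb (E k) + (r k)%:E))%E).
    by rewrite lee_pmul2l// lte_fin.
  rewrite ge0_muleDr// -?EFinM; last by rewrite lee_fin ltW.
  by rewrite leeD2l// lee_fin /r mulrCA mulfV// mulr1 mul1r.
pose g x : \bar R := (\sum_(0 <= k <oo) (k.+2%:R * \1_(U k) x)%:E)%E.
have tm0 k x : (0 <= (k.+2%:R * \1_(U k) x)%:E :> \bar R)%E by rewrite lee_fin mulr_ge0.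
have mind A k : measurable_fun A (\1_(U k) : R -> R) by apply: measurable_indic; exact: mU.
have mtm A k : measurable_fun A (fun x => (k.+2%:R * \1_(U k) x)%:E : \bar R).
  apply/measurable_EFinP; apply: measurable_funM.
    exact: measurable_cst.
  exact: (mind A k).
have mg (A : set R) : measurable_fun A g.
  exact: (@ge0_emeasurable_sum _ _ _ _ (fun k x => (k.+2%:R * \1_(U k) x)%:E) xpredT).
have g_ge0 x : (0 <= g x)%E by apply: nneseries_ge0.
have intg : (\int[leb]_(x in D) g x < +oo)%E.
  rewrite integral_nneseries; [|exact: mD|by move=> n; exact: mtm|by []].
  have -> : (\sum_(0 <= n <oo) \int[leb]_(x in D) (n.+2%:R * \1_(U n) x)%:E =
      \sum_(0 <= n <oo) (n.+2%:R%:E * leb (U n `&` D)))%E.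
    apply: eq_eseriesr => k _.
    under eq_integral do rewrite EFinM.
    rewrite ge0_integralZl_EFin//; last by apply/measurable_EFinP; exact: mind.
    by rewrite integral_indic; [|exact: mD|exact: mU].
  apply: (@le_lt_trans _ _ (\sum_(0 <= k <oo) (k.+2%:R%:E * leb (E k)) + 1%:E)%E).
    apply: le_trans (epsilon_trick xpredT _ ler01); last by move=> k; rewrite mule_ge0.
    by apply: lee_nneseries => // k _ _; rewrite mule_ge0.
  apply: lte_add_pinfty; last exact: ltry.
  apply: (@le_lt_trans _ _ (\int[leb]_(x in D) (g0 x)%:E)%E); last first.
    by have /integrableP[_] := intg0; under eq_integral => x _ do
      rewrite /comp gee0_abs ?lee_fin ?addr_ge0//.
  apply: (@le_trans _ _ (\int[leb]_(x in \bigcup_k E k) (g0 x)%:E)%E); last first.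
    apply: ge0_subset_integral => //.
    - exact: bigcupT_measurable.
    - exact: (measurable_int leb).
    - by move=> x _; rewrite lee_fin addr_ge0.
    - exact: bigcup_sub.
  have mg0 (A : set R) : measurable A -> A `<=` D -> measurable_fun A (EFin \o g0).
    by move=> mA AD; apply: (measurable_funS mD AD); exact: (measurable_int leb).
  rewrite ge0_integral_bigcup//.
  - apply: lee_nneseries => // k _; first by rewrite mule_ge0.
    rewrite -(integral_cst leb (mE k)); apply: ge0_le_integral => //.
    + exact: mE.
    + by move=> x _; rewrite lee_fin.
    + by apply: mg0; [exact: mE|exact: ED].
    + move=> x [_]; rewrite /= in_itv/= => /andP[kx _]; rewrite lee_fin /g0.
      by rewrite -addn2 natrD lerD2r.
  - by apply: mg0; [exact: bigcupT_measurable|exact: bigcup_sub].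
  - by move=> x _; rewrite lee_fin addr_ge0.
  - apply/trivIsetP => i j _ _ ij; apply/seteqP; split => // x [[_ +] [_]].
    rewrite /= !in_itv/= => /andP[i1 i2] /andP[j1 j2].
    move: (le_lt_trans i1 j2) (le_lt_trans j1 i2); rewrite !ltr_nat !ltnS.
    by move=> ? ?; move/eqP: ij; apply; apply/eqP; rewrite eqn_leq; apply/andP.
have gS (A B : set R) : measurable A -> measurable B -> A `<=` B ->
    (\int[leb]_(x in A) g x <= \int[leb]_(x in B) g x)%E.
  by move=> mA mB AB; apply: (ge0_subset_integral leb mA mB (mg B)).
pose G y : R := fine (\int[leb]_(x in `[p, y]) g x)%E.
have subD y : y \in `[p, q] -> `[p, y]%classic `<=` D.
  rewrite in_itv/= => /andP[_ yq] z; rewrite /D /= !in_itv/= => /andP[-> zy].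
  exact: le_trans yq.
have GE y : y \in `[p, q] -> (G y)%:E = (\int[leb]_(x in `[p, y]) g x)%E.
  move=> ypq; rewrite /G fineK// ge0_fin_numE ?integral_ge0//.
  by apply: le_lt_trans intg; apply: gS; [exact: measurable_itv|exact: mD|exact: subD].
have Gincr k x y : x \in `[p, q] -> y \in `[p, q] -> x <= y ->
    `]x, y]%classic `<=` U k -> k.+2%:R * (y - x) <= G y - G x.
  move=> xpq ypq xy xyU; rewrite -lee_fin EFinB !GE//.
  have px : p <= x by move: xpq; rewrite in_itv => /andP[].
  have -> : `[p, y]%classic = `[p, x]%classic `|` `]x, y]%classic.
    by rewrite -itv_bndbnd_setU ?bnd_simp.
  rewrite (ge0_integral_setU leb _ _ (mg _)); first last.
  - apply/disj_setPLR => z /=; rewrite !in_itv/= => /andP[_ zx]; apply/negP.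
    by rewrite negb_and -leNgt zx.
  - by move=> z _; exact: g_ge0.
  - exact: measurable_itv.
  - exact: measurable_itv.
  rewrite -GE// addeAC subee// add0e.
  apply: (@le_trans _ _ (\int[leb]_(z in `]x, y]) (cst k.+2%:R%:E) z)%E).
    rewrite (integral_cst leb (measurable_itv _)).
    rewrite [X in (_ <= _ * X)%E]lebesgue_measure_itv/= lte_fin.
    case: ltP => [_|yx]; first by rewrite EFinM.
    rewrite mule0 lee_fin.
    by rewrite mulr_ge0_le0 ?subr_le0.
  apply: ge0_le_integral.
  - exact: measurable_itv.
  - by move=> z _; rewrite lee_fin.
  - exact: measurable_cst.
  - exact: mg.
  move=> z zxy.
  have Uz : U k z by exact: xyU.
  apply: le_trans (@nneseries_lim_ge _ _ xpredT 0 k.+1 _) => //.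
  rewrite big_mkord big_ord_recr/= indicE mem_set//= mulr1.
  by rewrite leeDr// sume_ge0.
have Gnd x y : x \in `[p, q] -> y \in `[p, q] -> x <= y -> G x <= G y.
  move=> xpq ypq xy; rewrite -lee_fin !GE//; apply: gS;
    [exact: measurable_itv|exact: measurable_itv|].
  by move=> z /=; rewrite !in_itv/= => /andP[-> /le_trans]; apply.
exists G.
have loc x : x \in `[p, q] -> exists2 d : R, 0 < d & forall y, y \in `[p, q] ->
    `|y - x| < d -> `|f y - f x| <= `|G y - G x|.
  move=> xpq; have /is_derive_linear_approx/(_ _ ltr01)[d d0 Hd] := fdf x xpq.
  have /truncn_itv xk := normr_ge0 (df x); set k := Num.Def.truncn _ in xk.
  have Ux : U k x by apply: EU; split.
  have /nbhs_ballP[e /= e0 He] : nbhs x (U k) by exact: open_nbhs_nbhs.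
  exists (Num.min d e); first by rewrite lt_min d0.
  move=> y ypq; rewrite lt_min => /andP[yd ye].
  have fyx : `|f y - f x| <= k.+2%:R * `|y - x|.
    have := Hd y yd; have := ler_normD (f y - f x - df x * (y - x)) (df x * (y - x)).
    rewrite subrK normrM; move: xk => /andP[_ xk].
    have := normr_ge0 (y - x); rewrite -[k.+2]addn1 natrD; nra.
  apply: (le_trans fyx).
  have [xy|/ltW yx] := leP x y.
    rewrite !ger0_norm ?subr_ge0// ?Gnd//; apply: Gincr => // z /=.
    rewrite in_itv/= => /andP[xz zy]; apply: He; rewrite /ball/= ltr0_norm ?subr_lt0//.
    by rewrite opprB (le_lt_trans _ ye)// ger0_norm ?subr_ge0// lerB.
  rewrite !ler0_norm ?subr_le0// ?Gnd// !opprB; apply: Gincr => // z /=.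
  rewrite in_itv/= => /andP[yz zx]; apply: He; rewrite /ball/= ger0_norm ?subr_ge0//.
  by rewrite (le_lt_trans _ ye)// ler0_norm ?subr_le0// opprB lerB// ltW.
move=> x y xpq ypq xy.
have H1 : {in `[p, q] &, {homo (fun x => f x - G x) : x y /~ x <= y}}.
  apply: locally_nonincreasing => {y xpq ypq xy} x xpq.
  have [d d0 H] := loc x xpq; exists d => // y ypq /H -/(_ ypq).
  rewrite ler_norml => /andP[Ha Hb]; split => xy.
    by rewrite ger0_norm ?subr_ge0 ?Gnd// in Hb; lra.
  by rewrite ler0_norm ?subr_le0 ?Gnd// in Ha; lra.
have H2 : {in `[p, q] &, {homo (fun x => - f x - G x) : x y /~ x <= y}}.
  apply: locally_nonincreasing => {y xpq ypq xy} x xpq.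
  have [d d0 H] := loc x xpq; exists d => // y ypq /H -/(_ ypq).
  rewrite ler_norml => /andP[Ha Hb]; split => xy.
    by rewrite ger0_norm ?subr_ge0 ?Gnd// in Ha; lra.
  by rewrite ler0_norm ?subr_le0 ?Gnd// in Hb; lra.
have := H1 y x ypq xpq xy; have := H2 y x ypq xpq xy.
by rewrite ler_norml; lra.
Qed.

(** * Stieltjes integrals of continuous functions *)

Lemma segment_unif_continuous {R : realType} (a b : R) (phi : R -> R) (e : R) :
  continuous phi -> 0 < e -> exists2 d : R, 0 < d &
    forall x y, x \in `[a, b] -> `|y - x| < d -> `|phi y - phi x| < e.
Proof.
move=> cphi e0.
have e2 : 0 < e / 2 by rewrite divr_gt0.
have : \forall d \near 0^'+, forall x, `[a, b]%classic x ->
    forall y, `|y - x| < d -> `|phi y - phi x| < e.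
  apply: (compact_near_coveringP _).1 => [|x xab]; first exact: segment_compact.
  have /cvgrPdist_lt/(_ _ e2) := cphi x.
  move=> /nbhs_ballP[r /= r0 Hr].
  have r2 : 0 < r / 2 by rewrite divr_gt0.
  exists (ball x (r / 2), [set d : R | d < r / 2]).
    split => /=; first exact: nbhsx_ballx.
    exact: nbhs_right_lt.
  move=> [x' d]/= [xx' dr] y yd.
  have y1 : `|phi x - phi y| < e / 2.
    apply: Hr; rewrite /ball/=.
    rewrite (le_lt_trans (ler_distD x' _ _))// [ltRHS]splitr ltrD// distrC.
    exact: lt_trans dr.
  have x1 : `|phi x - phi x'| < e / 2.
    by apply: Hr; apply: le_ball xx'; rewrite ler_pdivrMr// ler_pMr// ler1n.
  by rewrite (le_lt_trans (ler_distD (phi x) _ _))// [ltRHS]splitr ltrD// distrC.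
move=> [d0 /= d00 H].
exists (d0 / 2) => [|x y xab yx]; first by rewrite divr_gt0.
apply: (H (d0 / 2)) xab _ yx; last by rewrite divr_gt0.
by rewrite /= sub0r normrN gtr0_norm ?divr_gt0// ltr_pdivrMr// ltr_pMr// ltr1n.
Qed.

Section stieltjes.
Context {R : realType}.
Implicit Types (G : cumulative R R) (phi : R -> R).

Lemma lebesgue_stieltjes_itv G (x y : R) : x <= y ->
  lebesgue_stieltjes_measure G `]x, y] = (G y - G x)%:E.
Proof.
move=> xy; rewrite /lebesgue_stieltjes_measure /measure_extension/=.
by rewrite measurable_mu_extE/= ?wlength_itv_bnd//; exact: is_ocitv.
Qed.

Lemma stieltjes_integrable G (x y : R) phi : continuous phi ->
  (lebesgue_stieltjes_measure G).-integrable `]x, y] (EFin \o phi).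
Proof.
move=> cphi; apply: measurable_bounded_integrable.
- exact: measurable_itv.
- have [xy|yx] := leP x y; first by rewrite [X in (X < _)%E]lebesgue_stieltjes_itv// ltry.
  by rewrite set_itv_ge ?measure0 ?ltry// bnd_simp -leNgt ltW.
- by apply: measurable_funS (continuous_measurable_fun cphi).
- have : bounded_set (phi @` `[x, y]%classic).
    apply: compact_bounded; apply: continuous_compact; last exact: segment_compact.
    exact: continuous_subspaceT.
  move=> [M [Mr H]]; exists M; split => // r Mr' z zxy.
  apply: (H r Mr'); exists z => //; move: zxy; rewrite /= !in_itv/= => /andP[/ltW -> ->//].
Qed.

Definition stieltjes_sum phi (D : R -> R) (x_ : nat -> R) (n : nat) : R :=
  \sum_(0 <= i < n) phi (x_ i.+1) * (D (x_ i.+1) - D (x_ i)).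

Lemma stieltjes_sum_approx G phi (x_ : nat -> R) (n : nat) (e : R) :
  continuous phi -> (forall i, x_ i <= x_ i.+1) ->
  (forall i z, (i < n)%N -> z \in `]x_ i, x_ i.+1] -> `|phi z - phi (x_ i.+1)| <= e) ->
  `|\int[lebesgue_stieltjes_measure G]_(z in `]x_ 0%N, x_ n]) phi z -
    stieltjes_sum phi G x_ n| <= e * (G (x_ n) - G (x_ 0%N)).
Proof.
move=> cphi xnd; elim: n => [|n IH] osc.
  by rewrite /stieltjes_sum big_geq// set_itv_ge ?bnd_simp// Rintegral_set0 !subrr normr0 mulr0.
have {}IH := IH (fun i z ni => osc i z (leqW ni)).
have x0n : x_ 0%N <= x_ n by elim: (n) => // m /le_trans; apply.
have xn := xnd n.
rewrite (_ : `]x_ 0%N, x_ n.+1]%classic =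
  `]x_ 0%N, x_ n]%classic `|` `]x_ n, x_ n.+1]%classic); last first.
  by rewrite -itv_bndbnd_setU ?bnd_simp.
have dis : [disjoint `]x_ 0%N, x_ n]%classic & `]x_ n, x_ n.+1]%classic].
  apply/disj_setPLR => z /=; rewrite !in_itv/= => /andP[_ zx]; apply/negP.
  by rewrite negb_and -leNgt zx.
rewrite Rintegral_setU//; last first.
  by rewrite -itv_bndbnd_setU ?bnd_simp//; exact: stieltjes_integrable.
rewrite /stieltjes_sum big_nat_recr//= -/(stieltjes_sum phi G x_ n).
have tri (u v s t A B : R) : `|u - s| <= A -> `|v - t| <= B -> `|u + v - (s + t)| <= A + B.
  by move=> uA vB; rewrite opprD addrACA (le_trans (ler_normD _ _))// lerD.
rewrite (_ : e * (G (x_ n.+1) - _) =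
  e * (G (x_ n) - G (x_ 0%N)) + e * (G (x_ n.+1) - G (x_ n))); last by ring.
apply: tri => //.
  have mE (r : R) : r * (G (x_ n.+1) - G (x_ n)) =
      \int[lebesgue_stieltjes_measure G]_(z in `]x_ n, x_ n.+1]) r.
    rewrite Rintegral_cst; last exact: measurable_itv.
    by rewrite [X in fine X]lebesgue_stieltjes_itv.
  have icst (r : R) : (lebesgue_stieltjes_measure G).-integrable `]x_ n, x_ n.+1] (EFin \o cst r).
    by apply: stieltjes_integrable => ?; exact: cst_continuous.
  rewrite !mE -RintegralB; [|exact: measurable_itv|exact: stieltjes_integrable|exact: icst].
  have ib : (lebesgue_stieltjes_measure G).-integrable `]x_ n, x_ n.+1]
      (EFin \o (fun z => phi z - phi (x_ n.+1))).
    apply: stieltjes_integrable => z; apply: cvgB; first exact: cphi.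
    exact: cvg_cst.
  apply: (@le_trans _ _ (\int[lebesgue_stieltjes_measure G]_(z in `]x_ n, x_ n.+1])
      `|phi z - phi (x_ n.+1)|)).
    by apply: le_normr_Rintegral => //; exact: measurable_itv.
  apply: le_Rintegral => //; first exact: integrable_norm ib.
    exact: icst.
  by move=> z zx; apply: osc => //; exact: zx.
Qed.

Lemma stieltjes_sumB phi (D1 D2 : R -> R) (x_ : nat -> R) (n : nat) :
  stieltjes_sum phi D1 x_ n - stieltjes_sum phi D2 x_ n =
  stieltjes_sum phi (fun x => D1 x - D2 x) x_ n.
Proof. by rewrite /stieltjes_sum -sumrB; apply: eq_bigr => i _; ring. Qed.

Lemma eq_stieltjes_sum (a b : R) phi (D1 D2 : R -> R) (x_ : nat -> R) (n : nat) :
  (forall i, x_ i \in `[a, b]) -> (forall x, x \in `[a, b] -> D1 x = D2 x) ->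
  stieltjes_sum phi D1 x_ n = stieltjes_sum phi D2 x_ n.
Proof. by move=> xab D12; rewrite /stieltjes_sum; apply: eq_bigr => i _; rewrite !D12. Qed.

(** The value of the signed integral for one decomposition of the integrator;
    [stieltjes_integral] chooses one of these values. *)
Definition stieltjes_pair (G1 G2 : cumulative R R) (a b : R) phi : R :=
  \int[lebesgue_stieltjes_measure G1]_(x in `]a, b]) phi x -
  \int[lebesgue_stieltjes_measure G2]_(x in `]a, b]) phi x.

(** Kept over plain reals, so that linear arithmetic does not meet any integral. *)
Lemma stieltjes_four_approx (i1 i2 j1 j2 s1 s2 t1 t2 c1 c2 c3 c4 M e : R) :
  `|i1 - s1| <= c1 -> `|i2 - s2| <= c2 -> `|j1 - t1| <= c3 -> `|j2 - t2| <= c4 ->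
  c1 + c2 + c3 + c4 <= e ->
  `|s1 - s2 - (t1 - t2)| <= M -> `|i1 - i2 - (j1 - j2)| <= M + e.
Proof.
rewrite !ler_norml => /andP[p1 p2] /andP[p3 p4] /andP[p5 p6] /andP[p7 p8] c /andP[p9 p10].
by apply/andP; split; lra.
Qed.

(** The Riemann-Stieltjes sums of a continuous function converge along uniform
    subdivisions, so any uniform bound on those sums passes to the integral. *)
Lemma stieltjes_pair_diff_le (a b : R) (G1 G2 H1 H2 : cumulative R R) phi (M : R) :
  a <= b -> continuous phi ->
  (forall (x_ : nat -> R) n, (forall i, x_ i <= x_ i.+1) ->
     (forall i, x_ i \in `[a, b]) -> x_ 0%N = a -> x_ n = b ->
    `|stieltjes_sum phi (fun x => (G1 x - G2 x) - (H1 x - H2 x)) x_ n| <= M) ->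
  `|stieltjes_pair G1 G2 a b phi - stieltjes_pair H1 H2 a b phi| <= M.
Proof.
move=> ab cphi HM; apply/ler_addgt0Pr => e e0.
(* the mass of the four measures, plus one to be positive *)
pose C : R := (G1 b - G1 a) + (G2 b - G2 a) + (H1 b - H1 a) + (H2 b - H2 a) + 1.
have nd (G : cumulative R R) : 0 <= G b - G a.
  by rewrite subr_ge0; exact: cumulative_is_nondecreasing.
have C0 : 0 < C.
  apply: ltr_wpDl; last exact: ltr01.
  exact: addr_ge0 (addr_ge0 (addr_ge0 (nd G1) (nd G2)) (nd H1)) (nd H2).
have eC : 0 < e / C by rewrite divr_gt0.
have [d d0 Hd] := @segment_unif_continuous R a b phi _ cphi eC.
pose N := (Num.bound ((b - a) / d)).+1.
have N0 : (0 : R) < N%:R by rewrite ltr0n.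
have Nd : (b - a) / N%:R < d.
  rewrite ltr_pdivrMr// mulrC -ltr_pdivrMr//.
  rewrite (lt_trans (archi_boundP _))//; first by rewrite divr_ge0 ?subr_ge0// ltW.
  by rewrite ltr_nat.
pose x_ (i : nat) : R := a + (b - a) / N%:R * (minn i N)%:R.
have c0 : 0 <= (b - a) / N%:R by rewrite divr_ge0 ?subr_ge0// ltW.
have x0 : x_ 0%N = a by rewrite /x_ min0n mulr0 addr0.
have xN : x_ N = b by rewrite /x_ minnn divfK ?gt_eqF// addrC subrK.
have xnd i : x_ i <= x_ i.+1.
  by rewrite /x_ lerD2l ler_wpM2l// ler_nat leq_min geq_minr andbT (leq_trans (geq_minl _ _)).
have xle i j : (i <= j)%N -> x_ i <= x_ j.
  elim: j => [|j IH]; first by rewrite leqn0 => /eqP ->.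
  by rewrite leq_eqVlt => /predU1P[->//|]; rewrite ltnS => /IH /le_trans; apply.
have xab i : x_ i \in `[a, b].
  rewrite in_itv/= -x0 xle//= -xN; have [iN|Ni] := leqP i N; first exact: xle.
  by rewrite /x_ minnn (minn_idPr (ltnW Ni)).
have osc i z : (i < N)%N -> z \in `]x_ i, x_ i.+1] -> `|phi z - phi (x_ i.+1)| <= e / C.
  move=> iN; rewrite in_itv/= => /andP[xz zx]; apply/ltW/Hd => //.
  rewrite ler0_norm ?subr_le0// opprB (le_lt_trans _ Nd)//.
  rewrite (@le_trans _ _ (x_ i.+1 - x_ i))//; first by rewrite lerB// ltW.
  rewrite /x_ (minn_idPl iN) (minn_idPl (ltnW iN)) opprD addrACA subrr add0r.
  by rewrite -mulrBr -natrB// subSnn mulr1.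
have app (G : cumulative R R) := @stieltjes_sum_approx G phi x_ N (e / C) cphi xnd osc.
rewrite x0 xN in app.
have := HM x_ N xnd xab x0 xN.
rewrite -!stieltjes_sumB /stieltjes_pair.
have E : e = e / C * (G1 b - G1 a) + e / C * (G2 b - G2 a) +
     e / C * (H1 b - H1 a) + e / C * (H2 b - H2 a) + e / C.
  by rewrite -!mulrDr -[X in _ = _ + X]mulr1 -mulrDr divfK// gt_eqF.
apply: stieltjes_four_approx (app G1) (app G2) (app H1) (app H2) _ => //.
by rewrite [leRHS]E lerDl ltW.
Qed.

(** Bounded variation without partitions, [V] standing for the variation function. *)
Definition dominated (phi V : R -> R) := forall x y, x <= y -> `|phi y - phi x| <= V y - V x.

(** Summation by parts moves the increments from the integrator, which may vary a lot,
    to [phi]; the boundary terms vanish with [phi]. *)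
Lemma stieltjes_sum_by_parts phi V (D : R -> R) (a b Delta : R) (x_ : nat -> R) (n : nat) :
  dominated phi V -> phi a = 0 -> phi b = 0 ->
  (forall x, x \in `[a, b] -> `|D x| <= Delta) ->
  (forall i, x_ i <= x_ i.+1) -> (forall i, x_ i \in `[a, b]) ->
  x_ 0%N = a -> x_ n = b ->
  `|stieltjes_sum phi D x_ n| <= Delta * (V b - V a).
Proof.
move=> phiV pa pb DD xnd xab x0 xn.
have -> : stieltjes_sum phi D x_ n = - \sum_(0 <= i < n) D (x_ i) * (phi (x_ i.+1) - phi (x_ i)).
  apply/eqP; rewrite -subr_eq0 opprK /stieltjes_sum -big_split/=.
  rewrite (eq_bigr (fun i => phi (x_ i.+1) * D (x_ i.+1) - phi (x_ i) * D (x_ i)));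
    last by move=> i _; ring.
  by rewrite telescope_sumr// x0 xn pa pb !mul0r subrr.
rewrite normrN (le_trans (ler_norm_sum _ _ _))//.
apply: (@le_trans _ _ (\sum_(0 <= i < n) Delta * (V (x_ i.+1) - V (x_ i)))).
  apply: ler_sum => i _; rewrite normrM ler_pM//; [exact: DD|exact: phiV].
by rewrite -mulr_sumr telescope_sumr// x0 xn.
Qed.

(** Two decompositions of [G] have the same Riemann-Stieltjes sums, hence give the same
    integral. *)
Lemma stieltjes_integralE (a b : R) (G : R -> R) (G1 G2 : cumulative R R) phi :
  a <= b -> continuous phi -> (forall x, x \in `[a, b] -> G x = G1 x - G2 x) ->
  stieltjes_integral a b G phi = stieltjes_pair G1 G2 a b phi.
Proof.
move=> ab cphi GE.
have : exists v : R, exists H1 H2 : cumulative R R,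
    (forall x, x \in `[a, b] -> G x = H1 x - H2 x) /\ v = stieltjes_pair H1 H2 a b phi.
  by exists (stieltjes_pair G1 G2 a b phi), G1, G2.
move=> /getPex[H1 [H2 [HE E]]].
rewrite (_ : stieltjes_integral a b G phi = stieltjes_pair H1 H2 a b phi)//.
apply/eqP; rewrite -subr_eq0 -normr_le0.
apply: stieltjes_pair_diff_le => // x_ n xnd xab x0 xn.
rewrite (@eq_stieltjes_sum a b _ _ (fun=> 0))// => [|x xab'].
  by rewrite /stieltjes_sum big1 ?normr0// => i _; rewrite subrr mulr0.
by rewrite -GE// -HE// subrr.
Qed.

(** The sup distance of the integrators is all that matters, however many jumps they
    have. *)
Lemma stieltjes_integral_diff_le (a b Delta : R) (G H : R -> R)
    (G1 G2 H1 H2 : cumulative R R) phi V :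
  a <= b -> continuous phi ->
  (forall x, x \in `[a, b] -> G x = G1 x - G2 x) ->
  (forall x, x \in `[a, b] -> H x = H1 x - H2 x) ->
  (forall x, x \in `[a, b] -> `|G x - H x| <= Delta) ->
  dominated phi V -> phi a = 0 -> phi b = 0 ->
  `|stieltjes_integral a b G phi - stieltjes_integral a b H phi| <= Delta * (V b - V a).
Proof.
move=> ab cphi GE HE GH phiV pa pb.
rewrite (stieltjes_integralE ab cphi GE) (stieltjes_integralE ab cphi HE).
apply: stieltjes_pair_diff_le => // x_ n xnd xab x0 xn.
by apply: (stieltjes_sum_by_parts phiV pa pb) => // x xab'; rewrite -GE// -HE// GH.
Qed.

End stieltjes.

(** * Smoothness and stability of the corrected estimator *)

Section estimator_derivative.
Context {R : realType}.
Implicit Types (G : cumulative R R) (phi : R -> R).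

Lemma stieltjes_Rintegral_le G (a b e : R) phi : a <= b -> continuous phi ->
  (forall x, x \in `[a, b] -> `|phi x| <= e) ->
  `|\int[lebesgue_stieltjes_measure G]_(x in `]a, b]) phi x| <= e * (G b - G a).
Proof.
move=> ab cphi phie.
have icst (r : R) : (lebesgue_stieltjes_measure G).-integrable `]a, b] (EFin \o cst r).
  by apply: stieltjes_integrable => ?; exact: cst_continuous.
have iphi := @stieltjes_integrable R G a b phi cphi.
have <- : \int[lebesgue_stieltjes_measure G]_(z in `]a, b]) e = e * (G b - G a).
  rewrite Rintegral_cst; last exact: measurable_itv.
  by rewrite [X in fine X]lebesgue_stieltjes_itv.
apply: (@le_trans _ _ (\int[lebesgue_stieltjes_measure G]_(z in `]a, b]) `|phi z|)).
  by apply: le_normr_Rintegral => //; exact: measurable_itv.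
apply: le_Rintegral => //; first exact: integrable_norm iphi.
  exact: icst.
by move=> z zab; apply: phie; exact: subset_itv_oc_cc zab.
Qed.

Lemma stieltjes_Rintegral_linear G (a b c : R) phi psi chi :
  continuous phi -> continuous psi -> continuous chi ->
  \int[lebesgue_stieltjes_measure G]_(x in `]a, b]) (phi x - psi x - c * chi x) =
  \int[lebesgue_stieltjes_measure G]_(x in `]a, b]) phi x -
  \int[lebesgue_stieltjes_measure G]_(x in `]a, b]) psi x -
  c * \int[lebesgue_stieltjes_measure G]_(x in `]a, b]) chi x.
Proof.
move=> cphi cpsi cchi.
have cB : continuous (fun x => phi x - psi x).
  by move=> x; apply: cvgB; [exact: cphi|exact: cpsi].
have cZ : continuous (fun x => c * chi x).
  by move=> x; apply: cvgM; [exact: cvg_cst|exact: cchi].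
rewrite RintegralB; [|exact: measurable_itv|exact: stieltjes_integrable cB|
  exact: stieltjes_integrable cZ].
rewrite RintegralB; [|exact: measurable_itv|exact: stieltjes_integrable|
  exact: stieltjes_integrable].
by rewrite RintegralZl; [|exact: measurable_itv|exact: stieltjes_integrable].
Qed.

Lemma stieltjes_two_combine (h c i1 j1 k1 i2 j2 k2 e1 e2 : R) : 0 <= h^-1 ->
  `|i1 - j1 - c / h * k1| <= e1 -> `|i2 - j2 - c / h * k2| <= e2 ->
  `|h^-1 * (i1 - i2) - h^-1 * (j1 - j2) - h ^- 2 * (k1 - k2) * c| <= h^-1 * (e1 + e2).
Proof.
move=> h0 H1 H2.
have -> : h^-1 * (i1 - i2) - h^-1 * (j1 - j2) - h ^- 2 * (k1 - k2) * c =
    h^-1 * ((i1 - j1 - c / h * k1) - (i2 - j2 - c / h * k2)).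
  by rewrite -exprVn; ring.
rewrite normrM (ger0_norm h0) ler_wpM2l// (le_trans (ler_normB _ _))// lerD//.
Qed.

(** Differentiation under the integral: [dK] is uniformly continuous on the segment
    reached by [(t - x) / h], so the remainder of the linear approximation of [K] is
    uniformly small, and both measures are finite. *)
Lemma kernel_estimator_is_derive (a b h t : R) (K dK G : R -> R) (G1 G2 : cumulative R R) :
  a <= b -> 0 < h ->
  (forall u, is_derive u (1 : R) K (dK u)) -> continuous dK ->
  (forall x, x \in `[a, b] -> G x = G1 x - G2 x) ->
  is_derive t (1 : R) (kernel_estimator a b K h G)
    (h ^- 2 * stieltjes_integral a b G (fun x => dK ((t - x) / h))).
Proof.
move=> ab h0 Kd cdK GE.
have hV0 : 0 < h^-1 by rewrite invr_gt0.
have cK : continuous K.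
  by move=> u; apply: differentiable_continuous; apply/derivable1_diffP; case: (Kd u).
have caff (s : R) : continuous (fun x : R => (s - x) / h).
  by move=> x; apply: cvgM; [apply: cvgB; [exact: cvg_cst|exact: cvg_id]|exact: cvg_cst].
have ckern (k : R -> R) (s : R) : continuous k -> continuous (fun x : R => k ((s - x) / h)).
  by move=> ck x; apply: continuous_comp; [exact: caff|exact: ck].
apply/is_derive_linear_approx => e e0.
pose C : R := (G1 b - G1 a) + (G2 b - G2 a) + 1.
have nd (H : cumulative R R) : 0 <= H b - H a.
  by rewrite subr_ge0; exact: cumulative_is_nondecreasing.
have C0 : 0 < C by apply: ltr_wpDl; [exact: addr_ge0 (nd G1) (nd G2)|exact: ltr01].
have C1 : (G1 b - G1 a) + (G2 b - G2 a) <= C by rewrite /C lerDl.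
clearbody C.
have e'0 : 0 < e * h ^+ 2 / C by rewrite divr_gt0// mulr_gt0// exprn_gt0.
have [d d0 Hd] := @segment_unif_continuous R ((t - b) / h) ((t - a) / h) dK _ cdK e'0.
exists (d * h); first by rewrite mulr_gt0.
move=> s std.
have taylor x : x \in `[a, b] ->
    `|K ((s - x) / h) - K ((t - x) / h) - (s - t) / h * dK ((t - x) / h)| <=
      e * h ^+ 2 / C * (`|s - t| / h).
  rewrite in_itv/= => /andP[ax xb].
  set u := (t - x) / h; set v := (s - x) / h.
  have uv : v - u = (s - t) / h by rewrite /u /v; field; rewrite gt_eqF.
  have uI : u \in `[(t - b) / h, (t - a) / h].
    by rewrite in_itv/= /u !ler_pM2r// !lerB.
  have vud : `|v - u| < d by rewrite uv normrM (gtr0_norm hV0) ltr_pdivrMr.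
  have wdK w : w \in `[Num.min u v, Num.max u v] -> `|dK w - dK u| <= e * h ^+ 2 / C.
    move=> wuv; apply/ltW/Hd => //; rewrite (le_lt_trans _ vud)//.
    move: wuv; rewrite in_itv/=; have [uv'|/ltW uv'] := leP u v => /andP[w1 w2].
      by rewrite !ger0_norm ?subr_ge0// lerB.
    by rewrite !ler0_norm ?subr_le0// !opprB lerB.
  have cKi (p q : R) : {within `[p, q], continuous K} by exact: continuous_subspaceT.
  have uvn : `|s - t| / h = `|v - u| by rewrite uv normrM (gtr0_norm hV0).
  rewrite uvn -uv.
  have [uv'|/ltW uv'] := leP u v.
    have [w wuv ->] := MVT_segment uv' (fun x _ => Kd x) (cKi _ _).
    rewrite mulrC -mulrBr normrM mulrC ler_wpM2r//; apply: wdK.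
    by rewrite (min_idPl uv') (max_idPr uv').
  have [w wuv E] := MVT_segment uv' (fun x _ => Kd x) (cKi _ _).
  have -> : K v - K u = dK w * (v - u) by rewrite -[LHS]opprB E -mulrN opprB.
  rewrite mulrC -mulrBr normrM mulrC ler_wpM2r//; apply: wdK.
  by rewrite (min_idPr uv') (max_idPl uv').
pose r x := K ((s - x) / h) - K ((t - x) / h) - (s - t) / h * dK ((t - x) / h).
have cr : continuous r.
  move=> x; apply: cvgB; first by apply: cvgB; exact: ckern.
  by apply: cvgM; [exact: cvg_cst|exact: ckern].
have B1 := @stieltjes_Rintegral_le G1 a b _ r ab cr taylor.
have B2 := @stieltjes_Rintegral_le G2 a b _ r ab cr taylor.
rewrite /kernel_estimator !(stieltjes_integralE ab _ GE)//; try exact: ckern.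
rewrite !stieltjes_Rintegral_linear// in B1 B2; try exact: ckern.
rewrite /stieltjes_pair.
set E := e * h ^+ 2 / C * _ in B1 B2.
have E0 : 0 <= E := mulr_ge0 (ltW e'0) (divr_ge0 (normr_ge0 _) (ltW h0)).
apply: le_trans (stieltjes_two_combine (ltW hV0) B1 B2) _.
apply: (@le_trans _ _ (h^-1 * (E * C))).
  by rewrite ler_pM2l// -mulrDr; exact: ler_wpM2l.
rewrite /E [leLHS](_ : _ = e * `|s - t|)//.
by move: C0 h0 => /gt_eqF/negbT C0 /gt_eqF/negbT h0; field; rewrite C0 h0.
Qed.

End estimator_derivative.

Section corrected.
Context {R : realType}.

(** Differentiates a function given by cases at a point where two of the cases meet. *)
Lemma is_derive_selection (k u v : R -> R) (t l e : R) : 0 < e ->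
  (forall s, `|s - t| < e -> k s = u s \/ k s = v s) ->
  u t = k t -> v t = k t ->
  is_derive t (1 : R) u l -> is_derive t (1 : R) v l -> is_derive t (1 : R) k l.
Proof.
move=> e0 kuv ut vt /is_derive_linear_approx du /is_derive_linear_approx dv.
apply/is_derive_linear_approx => eps eps0.
have [d1 d10 H1] := du _ eps0; have [d2 d20 H2] := dv _ eps0.
exists (Num.min e (Num.min d1 d2)); first by rewrite !lt_min e0 d10.
move=> s; rewrite !lt_min => /and3P[se s1 s2].
by have [->|->] := kuv s se; [rewrite -ut H1|rewrite -vt H2].
Qed.

Lemma is_derive_affine (p c l t : R) : is_derive t (1 : R) (fun s => c + l * (s - p)) l.
Proof.
apply/is_derive_linear_approx => e e0; exists 1 => // x _.
by rewrite (_ : _ - _ - _ = 0) ?normr0 ?mulr_ge0// ?ltW//; ring.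
Qed.

Definition clamp (p q t : R) : R := if t < p then p else if q < t then q else t.

Lemma clamp_itv (p q t : R) : p <= q -> clamp p q t \in `[p, q].
Proof.
move=> pq; rewrite /clamp in_itv/=; case: ltP => pt; first by rewrite lexx.
by case: ltP => qt; rewrite ?lexx ?pq ?pt ?qt.
Qed.

Lemma clamp_id (p q t : R) : t \in `[p, q] -> clamp p q t = t.
Proof. by rewrite in_itv/= /clamp => /andP[pt tq]; rewrite !ltNge pt tq. Qed.

Lemma le_clamp (p q : R) : p <= q -> {homo clamp p q : x y / x <= y}.
Proof.
move=> pq x y xy; rewrite /clamp.
case: (ltP x p) => xp; case: (ltP y p) => yp //;
  case: (ltP q x) => qx; case: (ltP q y) => qy //; lra.
Qed.

(** Outside [[p, q]] this is the tangent at the nearest end point, so that one formula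
    replaces the three cases of the corrected estimator. *)
Definition linear_extension (g dg : R -> R) (p q t : R) : R :=
  g (clamp p q t) + dg (clamp p q t) * (t - clamp p q t).

(** At [p] and at [q] the tangent and [g] have the same value and slope; [p = q] is
    allowed, and then the two tangents coincide. *)
Lemma linear_extension_is_derive (g dg : R -> R) (p q t : R) : p <= q ->
  (forall s, is_derive s (1 : R) g (dg s)) ->
  is_derive t (1 : R) (linear_extension g dg p q) (dg (clamp p q t)).
Proof.
move=> pq gd.
pose lp s := g p + dg p * (s - p); pose lq s := g q + dg q * (s - q).
have kE s : linear_extension g dg p q s = if s < p then lp s else if q < s then lq s else g s.
  rewrite /linear_extension /clamp; case: ltP => // ps; case: ltP => // sq.
  by rewrite subrr mulr0 addr0.
have dlp s : is_derive s (1 : R) lp (dg p) by exact: is_derive_affine.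
have dlq s : is_derive s (1 : R) lq (dg q) by exact: is_derive_affine.
have lpp : lp p = g p by rewrite /lp subrr mulr0 addr0.
have lqq : lq q = g q by rewrite /lq subrr mulr0 addr0.
rewrite /clamp; case: (ltP t p) => tp.
  have tp0 : 0 < p - t by rewrite subr_gt0.
  apply: (@is_derive_selection _ lp lp _ _ (p - t)) => //; last 2 first.
  - by rewrite kE tp.
  - by rewrite kE tp.
  move=> s; rewrite ltr_norml => /andP[_ s2]; left.
  have sp : s < p by lra.
  by rewrite kE sp.
case: (ltP q t) => qt.
  have qt0 : 0 < t - q by rewrite subr_gt0.
  apply: (@is_derive_selection _ lq lq _ _ (t - q)) => //; last 2 first.
  - by rewrite kE ltNge tp/= qt.
  - by rewrite kE ltNge tp/= qt.
  move=> s; rewrite ltr_norml => /andP[s1 _]; left.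
  have qs : q < s by lra.
  by rewrite kE ltNge (le_trans pq (ltW qs))/= qs.
have kt : linear_extension g dg p q t = g t by rewrite kE !ltNge tp qt.
have [tpE|tp'] := eqVneq t p.
  have [tqE|tq'] := eqVneq t q.
    apply: (@is_derive_selection _ lp g _ _ 1) => //; rewrite ?kt//; last 2 first.
    - by rewrite tpE.
    - by rewrite tpE; exact: dlp.
    move=> s _; rewrite kE; case: ltP => _; [by left|case: ltP => _; [left|by right]].
    by rewrite /lp /lq -tpE -tqE.
  have qt' : 0 < q - t by rewrite subr_gt0 lt_neqAle tq'.
  apply: (@is_derive_selection _ lp g _ _ (q - t)) => //; rewrite ?kt//; last 2 first.
  - by rewrite tpE.
  - by rewrite tpE; exact: dlp.
  move=> s; rewrite ltr_norml => /andP[_ s2]; have sq : s <= q by lra.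
  by rewrite kE; case: ltP => _; [left|rewrite ltNge sq; right].
have tp0 : 0 < t - p by rewrite subr_gt0 lt_neqAle eq_sym tp'.
have [tqE|tq'] := eqVneq t q.
  apply: (@is_derive_selection _ lq g _ _ (t - p)) => //; rewrite ?kt//; last 2 first.
  - by rewrite tqE.
  - by rewrite tqE; exact: dlq.
  move=> s; rewrite ltr_norml => /andP[s1 _]; have ps : p <= s by lra.
  by rewrite kE ltNge ps/=; case: ltP => _; [left|right].
have qt' : 0 < q - t by rewrite subr_gt0 lt_neqAle tq'.
apply: (@is_derive_selection _ g g _ _ (Num.min (t - p) (q - t))) => //.
  by rewrite lt_min tp0.
move=> s; rewrite lt_min !ltr_norml => /andP[/andP[s1 _] /andP[_ s2]]; left.
have ps : p <= s by lra.
have sq : s <= q by lra.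
by rewrite kE ltNge ps/= ltNge sq.
Qed.

Lemma corrected_kernel_estimatorE (a b h : R) (K G dg : R -> R) (t : R) :
  (forall s, is_derive s (1 : R) (kernel_estimator a b K h G) (dg s)) ->
  corrected_kernel_estimator a b K h G t =
  linear_extension (kernel_estimator a b K h G) dg (a + h) (b - h) t.
Proof.
move=> gd.
have dE s : derive1 (kernel_estimator a b K h G) s = dg s.
  by rewrite derive1E; case: (gd s).
rewrite /corrected_kernel_estimator /linear_extension /clamp !dE.
case: ltP => _; first by congr (_ + _ * _); ring.
case: ltP => _; first by congr (_ + _ * _); ring.
by rewrite subrr mulr0 addr0.
Qed.

(** As [f] vanishes at and beyond [p] and [q], clamping its argument does not change it,
    and domination on [[p, q]] becomes global, by a function of bounded oscillation. *)
Lemma dominated_clamp (f V : R -> R) (p q : R) : p <= q ->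
  (forall x y, x \in `[p, q] -> y \in `[p, q] -> x <= y -> `|f y - f x| <= V y - V x) ->
  (forall x, x <= p \/ q <= x -> f x = 0) ->
  dominated f (V \o clamp p q) /\ forall x y, (V \o clamp p q) y - (V \o clamp p q) x <= V q - V p.
Proof.
move=> pq fV f0.
have fE x : f x = f (clamp p q x).
  rewrite /clamp; case: ltP => xp; first by rewrite !f0//; left => //; exact: ltW.
  by case: ltP => qx; first by rewrite !f0//; right => //; exact: ltW.
have pI : p \in `[p, q] by rewrite in_itv/= lexx.
have qI : q \in `[p, q] by rewrite in_itv/= lexx pq.
have Vnd x y : x \in `[p, q] -> y \in `[p, q] -> x <= y -> V x <= V y.
  by move=> xI yI xy; have := le_trans (normr_ge0 _) (fV x y xI yI xy); rewrite subr_ge0.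
split=> [x y xy|x y] /=.
  by rewrite (fE x) (fE y); apply: fV; [exact: clamp_itv|exact: clamp_itv|exact: le_clamp].
have /andP[x1 x2] := clamp_itv x pq; have /andP[y1 y2] := clamp_itv y pq.
by apply: lerB; apply: Vnd => //; exact: clamp_itv.
Qed.

Lemma dominated_rescale (k V : R -> R) (h t : R) : 0 < h -> dominated k V ->
  dominated (fun x => k ((t - x) / h)) (fun x => - V ((t - x) / h)).
Proof.
move=> h0 kV x y xy; rewrite distrC opprK [leRHS]addrC; apply: (kV _ _ _).
by rewrite ler_pM2r ?invr_gt0// lerB.
Qed.

(** At distance at least [h] from both end points the rescaled kernel vanishes
    at [a] and [b], so integration by parts leaves no boundary term. *)
Lemma rescaled_integral_diff_le (a b h t v Delta : R) (k V G H : R -> R)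
    (G1 G2 H1 H2 : cumulative R R) :
  a <= b -> 0 < h -> continuous k -> dominated k V ->
  (forall x y, V y - V x <= v) -> (forall u, 1 <= `|u| -> k u = 0) ->
  (forall x, x \in `[a, b] -> G x = G1 x - G2 x) ->
  (forall x, x \in `[a, b] -> H x = H1 x - H2 x) ->
  0 <= Delta -> (forall x, x \in `[a, b] -> `|G x - H x| <= Delta) ->
  t \in `[a + h, b - h] ->
  `|stieltjes_integral a b G (fun x => k ((t - x) / h)) -
    stieltjes_integral a b H (fun x => k ((t - x) / h))| <= Delta * v.
Proof.
move=> ab h0 ck kV Vv k0 GE HE D0 GH; rewrite in_itv/= => /andP[t1 t2].
have hV0 : 0 < h^-1 by rewrite invr_gt0.
have cphi : continuous (fun x : R => k ((t - x) / h)).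
  move=> x; apply: continuous_comp; last exact: ck.
  by apply: cvgM; [apply: cvgB; [exact: cvg_cst|exact: cvg_id]|exact: cvg_cst].
have pa : k ((t - a) / h) = 0.
  apply: k0; rewrite normrM (gtr0_norm hV0) ler_pdivlMr// mul1r.
  by rewrite (le_trans _ (ler_norm _))//; lra.
have pb : k ((t - b) / h) = 0.
  apply: k0; rewrite normrM (gtr0_norm hV0) ler_pdivlMr// mul1r.
  by rewrite distrC (le_trans _ (ler_norm _))//; lra.
apply: le_trans (stieltjes_integral_diff_le ab cphi GE HE GH
  (dominated_rescale t h0 kV) pa pb) _.
by rewrite ler_wpM2l// opprK addrC.
Qed.

(** A point of a linear piece is within [h] of the tangency point, so there the bound on
    the slopes, which has one factor [h^-1] more, costs no more than the bound on the
    values. *)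
Lemma corrected_estimator_diff_le (a b h v0 v1 Delta t : R) (K dK V0 V1 G H : R -> R)
    (G1 G2 H1 H2 : cumulative R R) :
  0 < h -> 2 * h <= b - a ->
  (forall u, is_derive u (1 : R) K (dK u)) -> continuous dK ->
  dominated K V0 -> (forall x y, V0 y - V0 x <= v0) ->
  dominated dK V1 -> (forall x y, V1 y - V1 x <= v1) ->
  (forall u, 1 <= `|u| -> K u = 0) -> (forall u, 1 <= `|u| -> dK u = 0) ->
  (forall x, x \in `[a, b] -> G x = G1 x - G2 x) ->
  (forall x, x \in `[a, b] -> H x = H1 x - H2 x) ->
  0 <= Delta -> (forall x, x \in `[a, b] -> `|G x - H x| <= Delta) ->
  t \in `[a, b] ->
  let cG := corrected_kernel_estimator a b K h G in
  let cH := corrected_kernel_estimator a b K h H in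
  `|cG t - cH t| <= h^-1 * (v0 + v1) * Delta /\
  `|derive1 cG t - derive1 cH t| <= h ^- 2 * (v0 + v1) * Delta.
Proof.
move=> h0 hab Kd cdK KV Vv0 dKV Vv1 K0 dK0 GE HE D0 GH tab cG cH.
have ab : a <= b by lra.
have pq : a + h <= b - h by lra.
have hV0 : 0 < h^-1 by rewrite invr_gt0.
have cK : continuous K.
  by move=> u; apply: differentiable_continuous; apply/derivable1_diffP; case: (Kd u).
have v00 : 0 <= v0 by have := Vv0 0 0; rewrite subrr.
have v10 : 0 <= v1 by have := Vv1 0 0; rewrite subrr.
pose dg (F : R -> R) s := h ^- 2 * stieltjes_integral a b F (fun x => dK ((s - x) / h)).
have dG s : is_derive s (1 : R) (kernel_estimator a b K h G) (dg G s).
  exact: (kernel_estimator_is_derive s ab h0 Kd cdK GE).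
have dH s : is_derive s (1 : R) (kernel_estimator a b K h H) (dg H s).
  exact: (kernel_estimator_is_derive s ab h0 Kd cdK HE).
have cGE : cG = linear_extension (kernel_estimator a b K h G) (dg G) (a + h) (b - h).
  by apply/funext => s; exact: corrected_kernel_estimatorE.
have cHE : cH = linear_extension (kernel_estimator a b K h H) (dg H) (a + h) (b - h).
  by apply/funext => s; exact: corrected_kernel_estimatorE.
have dE (F dF : R -> R) s : (forall s, is_derive s (1 : R) F (dF s)) ->
    derive1 (linear_extension F dF (a + h) (b - h)) s = dF (clamp (a + h) (b - h) s).
  by move=> Fd; rewrite derive1E; case: (linear_extension_is_derive s pq Fd).
have cI := clamp_itv t pq; set c := clamp (a + h) (b - h) t in cI.
have gdiff : `|kernel_estimator a b K h G c - kernel_estimator a b K h H c| <= h^-1 * (Delta * v0).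
  rewrite /kernel_estimator -mulrBr normrM (gtr0_norm hV0) ler_pM2l//.
  exact: (rescaled_integral_diff_le ab h0 cK KV Vv0 K0 GE HE D0 GH cI).
have dgdiff : `|dg G c - dg H c| <= h ^- 2 * (Delta * v1).
  rewrite /dg -mulrBr normrM (gtr0_norm (_ : 0 < h ^- 2)) ?invr_gt0 ?exprn_gt0//.
  rewrite ler_pM2l ?invr_gt0 ?exprn_gt0//.
  exact: (rescaled_integral_diff_le ab h0 cdK dKV Vv1 dK0 GE HE D0 GH cI).
split; last first.
  rewrite cGE cHE !dE//; apply: (le_trans dgdiff).
  rewrite -mulrA ler_pM2l ?invr_gt0 ?exprn_gt0// mulrC ler_wpM2r// lerDr//.
have tc : `|t - c| <= h.
  move: tab; rewrite in_itv/= ler_norml /c /clamp => /andP[at_ tb].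
  by apply/andP; split; case: ltP => ?; try case: ltP => ?; lra.
rewrite cGE cHE /linear_extension -/c.
have -> : forall x y z w u : R, x + z * u - (y + w * u) = (x - y) + (z - w) * u by move=> *; ring.
apply: (le_trans (ler_normD _ _)); rewrite normrM.
have -> : h^-1 * (v0 + v1) * Delta = h^-1 * (Delta * v0) + h ^- 2 * (Delta * v1) * h.
  by field; rewrite gt_eqF.
by apply: lerD => //; apply: ler_pM.
Qed.

End corrected.

(** * Step functions and concave functions as differences of monotone functions *)

Section decompositions.
Context {R : realType}.

Lemma concave_onP (a b : R) (g : R -> R) : concave_on a b g <->
  forall x y k, x \in `[a, b] -> y \in `[a, b] -> 0 <= k <= 1 ->
    k * g x + (1 - k) * g y <= g (k * x + (1 - k) * y).
Proof.
split=> [gc x y k xab yab /andP[k0 k1]|gc].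
  have H := gc (Itv01 k0 k1) x y; rewrite !inE in H.
  have {}H : - g (k * x + (1 - k) * y) <= k * - g x + (1 - k) * - g y := H xab yab.
  lra.
move=> k x y; rewrite !inE => xab yab.
have kI : 0 <= k%:num <= 1 by apply/andP; split.
have H := gc x y k%:num xab yab kI.
suff : - g (k%:num * x + (1 - k%:num) * y) <= k%:num * - g x + (1 - k%:num) * - g y by [].
lra.
Qed.

Lemma affine_concave_on (a b c m t : R) : concave_on a b (fun x => c + m * (x - t)).
Proof.
by apply/concave_onP => x y k _ _ _; rewrite le_eqVlt; apply/orP; left; apply/eqP; ring.
Qed.

Lemma right_continuous_eq_near (f g : R -> R) (x e : R) : 0 < e ->
  (forall y, x <= y -> y < x + e -> f y = g y) ->
  g @ x^'+ --> g x -> f @ x^'+ --> f x.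
Proof.
move=> e0 fg gx; rewrite (fg x) ?ltrDl//.
apply: cvg_trans gx; apply: near_eq_cvg; near=> y; apply/esym/fg.
  by apply/ltW; near: y; exact: nbhs_right_gt.
by near: y; apply: nbhs_right_lt; rewrite ltrDl.
Unshelve. all: by end_near. Qed.

Lemma cumulative_of (g : R -> R) : nondecreasing g -> right_continuous g ->
  exists G : cumulative R R, G = g :> (R -> R).
Proof.
move=> gnd grc.
pose m := isCumulative.Build R _ R g gnd grc.
pose G : cumulative R R := HB.pack g m.
by exists G.
Qed.

Lemma cumulative_glue (t u : R) (H : cumulative R R) : u <= H t ->
  exists G : cumulative R R, forall x, G x = if x < t then u else H x.
Proof.
move=> uH; pose k x := if x < t then u else H x.
have nd : nondecreasing k.
  rewrite /k; move=> x y xy; case: ltP => xt; case: ltP => yt //.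
  - by rewrite (le_trans uH)//; exact: cumulative_is_nondecreasing.
  - by have := lt_le_trans yt (le_trans xt xy); rewrite ltxx.
  - exact: cumulative_is_nondecreasing.
have rc : right_continuous k.
  move=> x; have [xt|tx] := ltP x t.
    apply: (@right_continuous_eq_near k (fun=> u) x (t - x)); rewrite ?subr_gt0//.
      by move=> y _; rewrite addrC subrK /k => ->.
    exact: cvg_cst.
  apply: (@right_continuous_eq_near k H x 1) => //.
    by move=> y xy _; rewrite /k ltNge (le_trans tx xy).
  exact: cumulative_is_right_continuous.
by have [G GE] := cumulative_of nd rc; exists G => x; rewrite GE.
Qed.

Definition stieltjes_decomposable (a b : R) (G : R -> R) :=
  exists G1 G2 : cumulative R R, forall x, x \in `[a, b] -> G x = G1 x - G2 x.

(** By induction on the subdivision: in front of a decomposition on [[t, b]] both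
    components are prolonged by constants, low enough for them to stay nondecreasing. *)
Lemma cadlag_step_decomposable (a b : R) (G : R -> R) :
  cadlag_step_on a b G -> stieltjes_decomposable a b G.
Proof.
move=> [s sp]; elim: s a sp => [|t s IH] a sp step.
  have ab := itv_partition_nil sp.
  have cst_cum (c : R) : exists H : cumulative R R, forall x, H x = c.
    have [|x|H HE] := @cumulative_of (fun=> c); first by [].
      exact: cvg_cst.
    by exists H => x; rewrite HE.
  have [H1 H1E] := cst_cum (G b); have [H2 H2E] := cst_cum 0.
  exists H1, H2 => x; rewrite H1E H2E subr0 ab in_itv/= => /andP[bx xb].
  by congr G; apply/eqP; rewrite eq_le xb bx.
have at_ : a < t by case: sp => /= /andP[].
have [|H1 [H2 HE]] := IH t (itv_partition_cons sp).
  by move=> i si x; exact: (step i.+1 si x).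
pose u := Num.min (H1 t) (H2 t + G a).
have [G1 G1E] := @cumulative_glue t u H1 ltac:(by rewrite ge_min lexx).
have u2 : u - G a <= H2 t by rewrite lerBlDr ge_min lexx orbT.
have [G2 G2E] := cumulative_glue u2.
exists G1, G2 => x; rewrite in_itv/= => /andP[ax xb]; rewrite G1E G2E.
case: ltP => xt; last by apply: HE; rewrite in_itv/= xt.
rewrite opprB addrC subrK.
by have := step 0%N isT x; rewrite /= in_itv/= ax xt => /(_ isT).
Qed.

(** A concave function whose slopes are bounded above at the left end point
    differs from a linear function by a nondecreasing one.  Chords ending at [b] bound
    the slopes to the right of a point from below, which gives right continuity. *)
Lemma concave_decomposable (a b m : R) (H : R -> R) : a <= b -> concave_on a b H ->
  (forall x, x \in `[a, b] -> H x <= H a + m * (x - a)) ->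
  stieltjes_decomposable a b H.
Proof.
move=> ab /concave_onP Hc Hm.
have aI : a \in `[a, b] by rewrite in_itv/= lexx.
have bI : b \in `[a, b] by rewrite in_itv/= lexx ab.
(* the three-chord inequality *)
have chord x y z : a <= x -> x <= y -> y <= z -> z <= b ->
    (z - y) * H x + (y - x) * H z <= (z - x) * H y.
  move=> ax xy yz zb; have [xz|zx] := ltP x z; last first.
    have xyE : x = y by apply/eqP; rewrite eq_le xy (le_trans yz zx).
    have yzE : y = z by apply/eqP; rewrite eq_le yz -xyE zx.
    by rewrite -yzE -xyE !subrr !mul0r addr0.
  have zx0 : 0 < z - x by rewrite subr_gt0.
  have kI : 0 <= (z - y) / (z - x) <= 1.
    by rewrite divr_ge0 ?subr_ge0 ?(ltW xz)//= ler_pdivrMr// mul1r lerB.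
  have xI : x \in `[a, b] by rewrite in_itv/= ax (le_trans xy (le_trans yz zb)).
  have zI : z \in `[a, b] by rewrite in_itv/= zb (le_trans ax (le_trans xy yz)).
  have := Hc x z _ xI zI kI.
  have zx0' : z - x != 0 by rewrite gt_eqF.
  rewrite (_ : _ * x + _ * z = y); last by field.
  rewrite -(ler_pM2l zx0); congr (_ <= _); by field.
have slope x y : a <= x -> x <= y -> y <= b -> H y - H x <= m * (y - x).
  move=> ax xy yb; have [xa|ax'] := leP x a.
    have -> : x = a by apply/eqP; rewrite eq_le ax xa.
    have ay : a <= y by exact: le_trans ax xy.
    by have := Hm y; rewrite in_itv/= ay yb => /(_ isT); lra.
  have xa0 : 0 < x - a by rewrite subr_gt0.
  have := chord a x y (lexx _) ax xy yb.
  have := Hm x; rewrite in_itv/= ax (le_trans xy yb) => /(_ isT) Hx.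
  rewrite -subr_ge0 => C; rewrite -subr_ge0 -(pmulr_rge0 _ xa0).
  have yx0 : 0 <= y - x by rewrite subr_ge0.
  nra.
pose N x := m * clamp a b x - H (clamp a b x).
have Nnd : nondecreasing N.
  move=> x y xy; rewrite /N.
  have /andP[x1 x2] := clamp_itv x ab; have /andP[y1 y2] := clamp_itv y ab.
  by have := slope _ _ x1 (le_clamp ab xy) y2; lra.
have Nrc : right_continuous N.
  move=> x; have [bx|xb] := leP b x.
    apply: (@right_continuous_eq_near N (fun=> N x) x 1) => // [y xy _|]; last exact: cvg_cst.
    have cb z : b <= z -> clamp a b z = b.
      move=> bz; rewrite /clamp ltNge (le_trans ab bz)/=; case: ltP => // zb.
      by apply/eqP; rewrite eq_le bz zb.
    by rewrite /N !cb// (le_trans bx).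
  have [xa|ax] := ltP x a.
    apply: (@right_continuous_eq_near N (fun=> N x) x (a - x));
      [by rewrite subr_gt0|move=> y xy|exact: cvg_cst].
    by rewrite addrC subrK /N /clamp => ya; rewrite ya xa.
  apply/cvgrPdist_le => e e0.
  have bx0 : 0 < b - x by rewrite subr_gt0.
  pose c := `|m| + `|H b - H x| / (b - x) + 1.
  have c0 : 0 < c by rewrite /c ltr_wpDl// addr_ge0// divr_ge0// ltW.
  near=> y.
  have xy : x < y by near: y; exact: nbhs_right_gt.
  have yb : y < b by near: y; exact: nbhs_right_lt.
  have yec : y - x <= e / c.
    rewrite lerBlDl; near: y; apply: nbhs_right_le; rewrite ltrDl divr_gt0//.
  have xI : x \in `[a, b] by rewrite in_itv/= ax ltW.
  have yI : y \in `[a, b] by rewrite in_itv/= (le_trans ax (ltW xy)) ltW.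
  have NxE : N x = m * x - H x by rewrite /N clamp_id.
  have NyE : N y = m * y - H y by rewrite /N clamp_id.
  rewrite ler0_norm ?subr_le0 ?Nnd ?(ltW xy)// opprB.
  rewrite ler_pdivlMr// in yec; apply: le_trans yec.
  have yx0 : 0 < y - x by rewrite subr_gt0.
  have := chord x y b ax (ltW xy) (ltW yb) (lexx _).
  rewrite NxE NyE /c.
  set q := `|H b - H x| / (b - x).
  have qE : q * (b - x) = `|H b - H x| by rewrite /q divfK// gt_eqF.
  have q1 : - (H b - H x) <= q * (b - x) by rewrite qE -normrN ler_norm.
  move=> C.
  have C1 : (b - x) * (H x - H y) <= (b - x) * (q * (y - x)) by nra.
  rewrite ler_pM2l// in C1.
  have m1 : m <= `|m| by rewrite ler_norm.
  nra.
(* [m] may be negative, so the linear part is written as [`|m| - (`|m| - m)] *)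
have Lnd : nondecreasing (fun x => `|m| * clamp a b x).
  by move=> x y xy; rewrite ler_wpM2l// le_clamp.
have clamp_rc : right_continuous (clamp a b).
  move=> x; have [bx|xb] := leP b x.
    apply: (@right_continuous_eq_near (clamp a b) (fun=> b) x 1) => // [y xy _|];
      last exact: cvg_cst.
    rewrite /clamp ltNge (le_trans ab (le_trans bx xy))/=; case: ltP => // yb.
    by apply/eqP; rewrite eq_le (le_trans bx xy) yb.
  have [xa|ax] := ltP x a.
    apply: (@right_continuous_eq_near (clamp a b) (fun=> a) x (a - x));
      [by rewrite subr_gt0|move=> y xy|exact: cvg_cst].
    by rewrite addrC subrK /clamp => ->.
  apply: (@right_continuous_eq_near (clamp a b) id x (b - x)); [by rewrite subr_gt0|move=> y xy|].
    by rewrite addrC subrK => yb; rewrite clamp_id// in_itv/= (le_trans ax xy) ltW.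
  by apply: cvg_within_filter; exact: cvg_id.
have Lrc : right_continuous (fun x => `|m| * clamp a b x).
  by move=> x; apply: cvgM; [exact: cvg_cst|exact: clamp_rc].
have N2nd : nondecreasing (fun x => N x + (`|m| - m) * clamp a b x).
  move=> x y xy; apply: lerD; first exact: Nnd.
  by rewrite ler_wpM2l ?le_clamp// subr_ge0 ler_norm.
have N2rc : right_continuous (fun x => N x + (`|m| - m) * clamp a b x).
  move=> x; apply: cvgD; first exact: Nrc.
  by apply: cvgM; [exact: cvg_cst|exact: clamp_rc].
have [G1 G1E] := cumulative_of Lnd Lrc; have [G2 G2E] := cumulative_of N2nd N2rc.
by exists G1, G2 => x xab; rewrite G1E G2E /N clamp_id//; ring.
Unshelve. all: by end_near. Qed.

End decompositions.

(** * Least concave majorants *)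

Section least_concave_majorant.
Context {R : realType}.

Lemma lcm_le_line (a b c m t : R) (G H : R -> R) : is_least_concave_majorant a b G H ->
  (forall s, s \in `[a, b] -> G s <= c + m * (s - t)) ->
  forall s, s \in `[a, b] -> H s <= c + m * (s - t).
Proof. by move=> [_ _ least] Gline; apply: least => //; exact: affine_concave_on. Qed.

(** The line depends on the point [t] at which the majorant is to be bounded. *)
Lemma lcm_diff_le (a b Delta : R) (m G H : R -> R) : is_least_concave_majorant a b G H ->
  (forall s t, s \in `[a, b] -> t \in `[a, b] -> G s <= G t + Delta + m t * (s - t)) ->
  forall t, t \in `[a, b] -> `|H t - G t| <= Delta.
Proof.
move=> lcm Gline t tab; have [_ maj _] := lcm.
rewrite ger0_norm ?subr_ge0 ?maj// lerBlDl.
have := lcm_le_line lcm (fun s sab => Gline s t sab tab) tab.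
by rewrite subrr mulr0 addr0.
Qed.

(** A step function is constant to the right of [a] and bounded, so a steep enough line
    through its value at [a] lies above it, hence above its majorant. *)
Lemma lcm_step_decomposable (a b : R) (G H : R -> R) : a < b -> cadlag_step_on a b G ->
  is_least_concave_majorant a b G H -> stieltjes_decomposable a b H.
Proof.
move=> ab stepG lcm; have [Hc maj _] := lcm.
have [G1 [G2 GE]] := cadlag_step_decomposable stepG.
have aI : a \in `[a, b] by rewrite in_itv/= lexx ltW.
pose M := G1 b - G2 a.
have GM x : x \in `[a, b] -> G x <= M.
  move=> xab; rewrite GE//; move: xab; rewrite in_itv/= => /andP[ax xb].
  by apply: lerB; exact: cumulative_is_nondecreasing.
have [[|t s] sp step] := stepG.
  by move: ab; rewrite (itv_partition_nil sp) ltxx.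
have at_ : a < t by case: sp => /= /andP[].
have ta0 : 0 < t - a by rewrite subr_gt0.
pose m := `|M - G a| / (t - a).
have m0 : 0 <= m by rewrite divr_ge0// ltW.
have line x : x \in `[a, b] -> G x <= G a + m * (x - a).
  move=> xab; have := GM x xab; move: xab; rewrite in_itv/= => /andP[ax xb] GxM.
  have [xt|tx] := ltP x t.
    have := step 0%N isT x; rewrite /= in_itv/= ax xt => -> //.
    by rewrite lerDl mulr_ge0// subr_ge0.
  apply: (le_trans GxM); rewrite -lerBlDl (le_trans (ler_norm _))//.
  by rewrite /m mulrAC ler_pdivlMr// ler_wpM2l// lerB.
apply: (concave_decomposable (m := m) (ltW ab) Hc) => x xab.
apply: le_trans (lcm_le_line lcm line xab) _.
by rewrite lerD2r maj.
Qed.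

End least_concave_majorant.

(** * Levy's modulus of continuity *)

Section chaining.
Context {R : realType}.

(** Let [p k t] be the last point of the grid of mesh [2 ^ -k] not beyond [t].  The points
    [p k t] and [p (k + 1) t] are equal or neighbours on the finer grid, and so are
    [p k s] and [p k t] on the grid [k] when the lag is at most the mesh; summing over the
    finer grids, for [s] and for [t], costs [C * y k] each. *)
Lemma chaining (z : R -> R) (y : nat -> R) (C : R) :
  {within `[0, 1], continuous z} ->
  (forall k j, (j < 2 ^ k)%N ->
     `|z (j.+1%:R / (2 ^ k)%:R) - z (j%:R / (2 ^ k)%:R)| <= y k) ->
  (forall k n, \sum_(i < n) y (k + i)%N <= C * y k) ->
  forall k s t, s \in `[0, 1] -> t \in `[0, 1] -> `|s - t| <= (2 ^ k)%:R^-1 ->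
    `|z s - z t| <= (2 * C + 1) * y k.
Proof.
move=> zc zy ysum.
have y0 k : 0 <= y k.
  by apply: le_trans (zy k 0%N _); rewrite ?normr_ge0// expn_gt0.
have p2 k : (0 : R) < (2 ^ k)%:R by rewrite ltr0n expn_gt0.
pose J k (t : R) := Num.truncn (t * (2 ^ k)%:R).
pose p k t : R := (J k t)%:R / (2 ^ k)%:R.
have JP k t : 0 <= t -> (J k t)%:R <= t * (2 ^ k)%:R < (J k t).+1%:R.
  by move=> t0; apply: truncn_itv; rewrite mulr_ge0// ltW.
have step k t : t \in `[0, 1] -> `|z (p k.+1 t) - z (p k t)| <= y k.+1.
  rewrite in_itv/= => /andP[t0 t1].
  have /andP[a1 a2] := JP k t t0; have /andP[b1 b2] := JP k.+1 t t0.
  have e2 : (2 ^ k.+1)%:R = 2 * (2 ^ k)%:R :> R by rewrite expnS natrM.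
  have l1 : ((J k t).*2 <= J k.+1 t)%N.
    rewrite -ltnS -(ltr_nat R) (le_lt_trans _ b2)// -muln2 natrM e2 mulrCA mulrC.
    by rewrite ler_pM2l.
  have l2 : (J k.+1 t < (J k t).*2.+2)%N.
    rewrite -(ltr_nat R) (le_lt_trans b1)// -doubleS -muln2 natrM e2 mulrCA mulrC.
    by rewrite ltr_pM2r.
  have pkE : p k t = (J k t).*2%:R / (2 ^ k.+1)%:R.
    by rewrite /p e2 -muln2 natrM; field; rewrite gt_eqF.
  move: l1; rewrite leq_eqVlt => /predU1P[E|l1].
    by rewrite {1}/p -E pkE subrr normr0.
  have E : J k.+1 t = (J k t).*2.+1 by apply/eqP; rewrite eqn_leq -ltnS l2 l1.
  rewrite {1}/p E pkE; apply: zy.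
  rewrite -(ltr_nat R) (lt_le_trans (y := (J k.+1 t)%:R))//; first by rewrite E ltr_nat.
  by rewrite (le_trans b1)// ler_piMl// ltW.
have tele k n t : t \in `[0, 1] -> `|z (p (k + n)%N t) - z (p k t)| <= C * y k.
  move=> tI; apply: le_trans (ysum k n.+1).
  rewrite big_ord_recl/= addn0 ler_wpDl//.
  elim: n => [|n IH]; first by rewrite addn0 subrr normr0 big_ord0.
  rewrite big_ord_recr/= (le_trans (ler_distD (z (p (k + n)%N t)) _ _))// addrC lerD//.
  by rewrite /bump/= add1n addnS; exact: step.
have pdist k t : t \in `[0, 1] -> `|p k t - t| <= (2 ^ k)%:R^-1 /\ p k t \in `[0, 1].
  rewrite in_itv/= => /andP[t0 t1]; have /andP[a1 a2] := JP k t t0.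
  have pt : p k t <= t by rewrite /p ler_pdivrMr.
  split.
    rewrite ler0_norm ?subr_le0// opprB /p lerBlDr -[X in X + _]mul1r -mulrDl.
    by rewrite ler_pdivlMr// nat1r ltW.
  by rewrite in_itv/= (le_trans pt)// andbT divr_ge0// ltW.
have lim k t : t \in `[0, 1] -> `|z t - z (p k t)| <= C * y k.
  move=> tI; apply/ler_addgt0Pr => e e0.
  have /subspace_continuousP/(_ t tI)/cvgrPdist_le/(_ e e0) := zc.
  move=> /nbhs_ballP[d /= d0 Hd].
  pose n := Num.bound d^-1.
  have nd : (2 ^ (k + n))%:R^-1 < d.
    rewrite invf_plt ?posrE// (lt_le_trans (archi_boundP _)) ?invr_ge0 ?(ltW d0)//.
    rewrite ler_nat (leq_trans (ltnW (ltn_expl n (isT : (1 < 2)%N))))//.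
    by rewrite leq_exp2l// leq_addl.
  have [pd pI] := pdist (k + n)%N t tI.
  have := Hd (p (k + n)%N t); rewrite /ball/= distrC => /(_ (le_lt_trans pd nd) pI) H.
  rewrite (le_trans (ler_distD (z (p (k + n)%N t)) _ _))// addrC lerD//.
  exact: tele.
have main k s t : s \in `[0, 1] -> t \in `[0, 1] -> s <= t -> t - s <= (2 ^ k)%:R^-1 ->
    `|z s - z t| <= (2 * C + 1) * y k.
  move=> sI tI st ts.
  have adj : `|z (p k s) - z (p k t)| <= y k.
    have /andP[s0 s1] : 0 <= s <= 1 by move: sI; rewrite in_itv.
    have /andP[t0 t1] : 0 <= t <= 1 by move: tI; rewrite in_itv.
    have /andP[a1 a2] := JP k s s0; have /andP[b1 b2] := JP k t t0.
    have l1 : (J k s <= J k t)%N.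
      by rewrite -ltnS -(ltr_nat R) (le_lt_trans a1)// (le_lt_trans _ b2)// ler_pM2r.
    have l2 : (J k t < (J k s).+2)%N.
      rewrite -(ltr_nat R) (le_lt_trans b1)// -natr1.
      rewrite (le_lt_trans (y := s * (2 ^ k)%:R + 1)) ?ltrD2r//.
      by rewrite -lerBlDl -mulrBl -ler_pdivlMr// mul1r.
    move: l1; rewrite leq_eqVlt => /predU1P[E|l1].
      by rewrite /p E subrr normr0.
    have E : J k t = (J k s).+1 by apply/eqP; rewrite eqn_leq -ltnS l2 l1.
    rewrite distrC /p E; apply: zy.
    by rewrite -(ler_nat R) -E (le_trans b1)// ler_piMl// ltW.
  have := lim k s sI; have := lim k t tI; move: adj.
  by rewrite !ler_norml => /andP[? ?] /andP[? ?] /andP[? ?]; apply/andP; split; lra.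
move=> k s t sI tI; have [st|/ltW ts] := leP s t => d; last first.
  by rewrite distrC; apply: main => //; rewrite ger0_norm ?subr_ge0// in d.
by apply: main => //; rewrite ler0_norm ?subr_le0// opprB in d.
Qed.

(** Up to a constant, the size of the largest increment of a Brownian path
    between neighbours of the dyadic grid of mesh [2 ^ -k]. *)
Definition levy_modulus (k : nat) : R := Num.sqrt (k.+1%:R / (2 ^ k)%:R).

(** Geometric decay: [k + i + 1 <= (k + 1) (i + 1)], and [sqrt ((i + 1) / 2 ^ i)] is at
    most [3 (3 / 4) ^ i]. *)
Lemma sum_levy_modulus (k n : nat) : \sum_(i < n) levy_modulus (k + i) <= 12 * levy_modulus k.
Proof.
have p2 m : (0 : R) < (2 ^ m)%:R by rewrite ltr0n expn_gt0.
have bern i : 8 + i%:R <= 8 * (9 / 8) ^+ i :> R.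
  elim: i => [|i IH]; first by rewrite expr0 addr0 mulr1.
  rewrite exprS -[i.+1%:R]natr1; have i0 : (0 : R) <= i%:R by [].
  lra.
have term i : levy_modulus (k + i) <= levy_modulus k * (3 * (3 / 4) ^+ i).
  have r0 : (0 : R) <= 3 * (3 / 4) ^+ i by rewrite mulr_ge0// exprn_ge0.
  have lk0 m : 0 <= m.+1%:R / (2 ^ m)%:R :> R by rewrite divr_ge0.
  rewrite /levy_modulus -[3 * _](ger0_norm r0) -sqrtr_sqr -sqrtrM//.
  rewrite ler_sqrt ?mulr_ge0 ?sqr_ge0//.
  have -> : (3 * (3 / 4) ^+ i) ^+ 2 = 9 * (9 / 8) ^+ i / (2 ^ i)%:R :> R.
    rewrite exprMn -exprM mulnC exprM -[LHS]mulr1 natrX.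
    rewrite (_ : (3 / 4) ^+ 2 = 9 / 8 / 2 :> R); last by field.
    by rewrite [in LHS]expr_div_n mulr1; field; rewrite expf_eq0/= pnatr_eq0 andbF.
  rewrite expnD natrM invfM [leRHS]mulrACA ler_pM2r; last first.
    by apply: mulr_gt0; rewrite invr_gt0.
  have ki : ((k + i).+1 <= k.+1 * i.+1)%N by rewrite mulSn mulnS; lia.
  apply: (@le_trans _ _ (k.+1%:R * i.+1%:R)); first by rewrite -natrM ler_nat.
  rewrite ler_wpM2l//; have := bern i; have i0 : (0 : R) <= i%:R by [].
  have : (0 : R) <= (9 / 8) ^+ i by rewrite exprn_ge0.
  rewrite -[i.+1%:R]natr1; lra.
apply: (@le_trans _ _ (\sum_(i < n) levy_modulus k * (3 * (3 / 4) ^+ i))).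
  by apply: ler_sum => i _.
rewrite -mulr_sumr mulrC ler_wpM2r ?sqrtr_ge0// -mulr_sumr.
have -> : \sum_(i < n) (3 / 4) ^+ i = 4 * (1 - (3 / 4) ^+ n) :> R.
  elim: n => [|n IH]; first by rewrite big_ord0 expr0 subrr mulr0.
  by rewrite big_ord_recr/= IH exprS; lra.
have : (0 : R) <= (3 / 4) ^+ n by rewrite exprn_ge0.
lra.
Qed.

End chaining.

Section modulus_rate.
Context {R : realType}.

Lemma ln2_ge : 1 / 2 <= ln 2 :> R.
Proof.
have := @le_ln1Dx R (- (1 / 2)).
have -> : 1 + - (1 / 2) = 2^-1 :> R by field.
by rewrite lnV ?posrE//; lra.
Qed.

Lemma ln_ge1 (n : nat) : (4 <= n)%N -> 1 <= ln n%:R :> R.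
Proof.
move=> n4; apply: (@le_trans _ _ (ln 4)).
  by rewrite (_ : 4 = 2 ^+ 2 :> R) ?lnXn//; [rewrite mulr2n; have := ln2_ge; lra|rewrite -natrX].
by rewrite ler_ln ?posrE ?ler_nat ?ltr0n// (leq_trans _ n4).
Qed.

(** The grid to be used for a lag [tau]: its mesh is comparable with [tau]. *)
Lemma dyadic_scale (tau : R) : 0 < tau -> tau <= 1 ->
  exists2 k, tau <= (2 ^ k)%:R^-1 & (2 ^ k)%:R^-1 < 2 * tau.
Proof.
move=> t0 t1.
have p2 m : (0 : R) < (2 ^ m)%:R by rewrite ltr0n expn_gt0.
have ex : exists k, (2 ^ k)%:R^-1 < 2 * tau.
  have tt0 : 0 < 2 * tau by rewrite mulr_gt0.
  exists (Num.bound (2 * tau)^-1).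
  rewrite invf_plt ?posrE// (lt_le_trans (archi_boundP _)) ?invr_ge0 ?(ltW tt0)//.
  by rewrite ler_nat; exact: ltnW (ltn_expl _ _).
have [k kt kmin] := ex_minnP ex; exists k => //.
case: k kt kmin => [_ _|k kt kmin]; first by rewrite expn0 invr1.
rewrite leNgt; apply/negP => kt'.
have : (k.+1 <= k)%N; last by rewrite ltnn.
apply: kmin; move: kt'; rewrite expnS natrM invfM => kt'.
have := p2 k; rewrite -invr_gt0; lra.
Qed.

(** Since [k ln 2 = ln (2 ^ k / n) + ln n <= 2 ^ k / n + ln n], the logarithm [k] of the
    scale is controlled by that of [n], up to a term that after division by [2 ^ k n] is
    [O (n ^ -2)]. *)
Lemma levy_modulus_rate (n k : nat) (eta tau : R) : (4 <= n)%N ->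
  0 <= eta -> eta ^+ 3 = ln n%:R / n%:R -> 0 <= tau ->
  (2 ^ k)%:R^-1 < 2 * tau ->
  k.+1%:R / (2 ^ k)%:R / n%:R <= 6 * tau * eta ^+ 3 + 2 * eta ^+ 4 :> R.
Proof.
move=> n4 eta0 etaE tau0 ktau.
have p2 m : (0 : R) < (2 ^ m)%:R by rewrite ltr0n expn_gt0.
have n0 : (0 : R) < n%:R by rewrite ltr0n (leq_trans _ n4).
have lnn := ln_ge1 n4.
have kl : k%:R / 2 <= ln n%:R + (2 ^ k)%:R / n%:R :> R.
  have : ln ((2 ^ k)%:R / n%:R) < (2 ^ k)%:R / n%:R :> R.
    by apply: ln_sublinear; rewrite divr_gt0.
  have lnE : ln (2 ^ k)%:R = k%:R * ln 2 :> R by rewrite natrX lnXn// mulr_natl.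
  rewrite ln_div ?posrE// lnE.
  have := ln2_ge; have k0 : (0 : R) <= k%:R by [].
  nra.
have etan : n%:R^-1 <= eta ^+ 3.
  by rewrite etaE -[leLHS]mul1r ler_pM2r ?invr_gt0.
have eta1 : eta <= 1.
  rewrite leNgt; apply/negP => eta1.
  have : 1 < eta ^+ 3 by rewrite exprn_egt1.
  by rewrite etaE ltr_pdivlMr// mul1r ltNge (ltW (ln_sublinear n0)).
have k3 : k.+1%:R <= 3 * ln n%:R + 2 * ((2 ^ k)%:R / n%:R) :> R.
  by rewrite -[k.+1%:R]natr1; lra.
apply: (@le_trans _ _ ((3 * ln n%:R + 2 * ((2 ^ k)%:R / n%:R)) / (2 ^ k)%:R / n%:R)).
  by rewrite !ler_pM2r ?invr_gt0.
have -> : (3 * ln n%:R + 2 * ((2 ^ k)%:R / n%:R)) / (2 ^ k)%:R / n%:R =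
    3 * (2 ^ k)%:R^-1 * eta ^+ 3 + 2 * (n%:R^-1 * n%:R^-1).
  by rewrite etaE; field; rewrite !gt_eqF.
have e30 : 0 <= eta ^+ 3 by rewrite exprn_ge0.
apply: lerD; first by rewrite ler_wpM2r//; lra.
rewrite ler_pM2l//; apply: (@le_trans _ _ (eta ^+ 3 * eta ^+ 3)).
  by rewrite ler_pM// invr_ge0 ltW.
by rewrite -exprD ler_wiXn2l.
Qed.

Definition rate_constant (A e : R) : R := A ^+ 2 * (6 * (8 * A ^+ 2 / e ^+ 2 + 1) + 2) + 1.

Lemma rate_constant_ge0 (A e : R) : 0 <= rate_constant A e.
Proof.
have q0 : 0 <= 8 * A ^+ 2 / e ^+ 2.
  by apply: divr_ge0; [apply: mulr_ge0 => //|]; exact: sqr_ge0.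
by rewrite /rate_constant addr_ge0// mulr_ge0 ?sqr_ge0//; lra.
Qed.

(** Young's inequality in the form used below: the square root of [tau * eta ^ 3] is
    at most a small multiple of [tau ^ 2] plus a large multiple of [eta ^ 2]. *)
Lemma young_rate (A e eta tau w : R) : 0 <= A -> 0 < e -> 0 <= eta -> 0 <= tau ->
  w <= 6 * tau * eta ^+ 3 + 2 * eta ^+ 4 ->
  A * Num.sqrt w <= e * tau ^+ 2 + rate_constant A e * eta ^+ 2.
Proof.
move=> A0 e0 eta0 tau0 wle; rewrite /rate_constant; set B := 8 * A ^+ 2 / e ^+ 2 + 1.
have B1 : 1 <= B.
  by rewrite /B lerDr; apply: divr_ge0; [apply: mulr_ge0 => //|]; exact: sqr_ge0.
have B0 : 0 <= B by rewrite (le_trans _ B1).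
set C := A ^+ 2 * (6 * B + 2) + 1.
have C1 : 1 <= C.
  by rewrite /C lerDr; apply: mulr_ge0; [exact: sqr_ge0|lra].
have C0 : 0 <= C by rewrite (le_trans _ C1).
have rhs0 : 0 <= e * tau ^+ 2 + C * eta ^+ 2.
  by rewrite addr_ge0// mulr_ge0 ?sqr_ge0// ltW.
have [w0|/ltW w0] := leP 0 w; last by rewrite ler0_sqrtr// mulr0.
rewrite -(ler_pXn2r (ltn0Sn 1)) ?nnegrE ?mulr_ge0 ?sqrtr_ge0//.
rewrite exprMn sqr_sqrtr//.
have e2 : 0 <= e * tau ^+ 2 by rewrite mulr_ge0 ?sqr_ge0// ltW.
have c2 : 0 <= C * eta ^+ 2 by rewrite mulr_ge0 ?sqr_ge0.
have A2 : 0 <= A ^+ 2 by rewrite sqr_ge0.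
apply: (@le_trans _ _ (A ^+ 2 * (6 * tau * eta ^+ 3 + 2 * eta ^+ 4))).
  exact: ler_wpM2l.
have [tB|Bt] := leP tau (B * eta).
  apply: (@le_trans _ _ ((C * eta ^+ 2) ^+ 2)); last first.
    by rewrite ler_pXn2r ?nnegrE ?lerDr.
  apply: (@le_trans _ _ (A ^+ 2 * ((6 * B + 2) * eta ^+ 4))).
    apply: ler_wpM2l => //.
    have : tau * eta ^+ 3 <= B * eta * eta ^+ 3 by rewrite ler_wpM2r// exprn_ge0.
    have -> : B * eta * eta ^+ 3 = B * eta ^+ 4 by ring.
    lra.
  rewrite mulrA exprMn -exprM/=; apply: ler_wpM2r; first by rewrite exprn_ge0.
  apply: (@le_trans _ _ C); first by rewrite /C lerDl.
  by rewrite expr2 ler_peMl.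
have eB : B * eta <= tau by exact: ltW.
have eta_le : eta <= tau by rewrite (le_trans _ eB)// ler_peMl.
apply: (@le_trans _ _ ((e * tau ^+ 2) ^+ 2)); last first.
  by rewrite ler_pXn2r ?nnegrE ?lerDl.
have h1 : eta ^+ 3 * B <= tau ^+ 3.
  have : eta * B * (eta * eta) <= tau * (tau * tau).
    apply: ler_pM => //; rewrite ?mulr_ge0//; first by rewrite mulrC.
    exact: ler_pM.
  by rewrite !exprS expr0 !mulr1; lra.
have h2 : eta ^+ 4 * B <= tau ^+ 4.
  have -> : eta ^+ 4 * B = eta * (eta ^+ 3 * B) by ring.
  by rewrite [tau ^+ 4]exprS ler_pM// mulr_ge0// exprn_ge0.
have h3 : (6 * tau * eta ^+ 3 + 2 * eta ^+ 4) * B <= 8 * tau ^+ 4.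
  have : tau * (eta ^+ 3 * B) <= tau * tau ^+ 3 by apply: ler_wpM2l.
  rewrite -exprS; lra.
have h4 : 8 * A ^+ 2 <= B * e ^+ 2.
  by rewrite /B [leRHS]mulrDl divfK ?lerDl ?mul1r ?sqr_ge0// gt_eqF// exprn_gt0.
have Bpos : 0 < B by rewrite (lt_le_trans _ B1).
rewrite -(ler_pM2r Bpos) -[leLHS]mulrA.
apply: (@le_trans _ _ (A ^+ 2 * (8 * tau ^+ 4))); first exact: ler_wpM2l.
have -> : A ^+ 2 * (8 * tau ^+ 4) = 8 * A ^+ 2 * tau ^+ 4 by ring.
have -> : (e * tau ^+ 2) ^+ 2 * B = B * e ^+ 2 * tau ^+ 4 by ring.
by rewrite ler_wpM2r ?exprn_ge0.
Qed.

(** The modulus is used on the grid adapted to the lag; Young's inequality does the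
    rest. *)
Lemma modulus_rate (n : nat) (eta A e : R) (z : R -> R) : (4 <= n)%N -> 0 <= A -> 0 < e ->
  0 <= eta -> eta ^+ 3 = ln n%:R / n%:R ->
  (forall k s t, s \in `[0, 1] -> t \in `[0, 1] -> `|s - t| <= (2 ^ k)%:R^-1 ->
    `|z s - z t| <= A * levy_modulus k) ->
  forall s t, s \in `[0, 1] -> t \in `[0, 1] ->
    n%:R `^ (- (1 / 2)) * `|z s - z t| <=
      e * (s - t) ^+ 2 + rate_constant A e * eta ^+ 2.
Proof.
move=> n4 A0 e0 eta0 etaE zA s t sI tI.
have n0 : (0 : R) < n%:R by rewrite ltr0n (leq_trans _ n4).
have [->|st] := eqVneq s t.
  rewrite !subrr normr0 mulr0 addr_ge0 ?mulr_ge0 ?sqr_ge0 ?(ltW e0)//.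
  exact: rate_constant_ge0.
have tau0 : 0 < `|s - t| by rewrite normr_gt0 subr_eq0.
have tau1 : `|s - t| <= 1.
  by move: sI tI; rewrite !in_itv/= ler_norml => /andP[? ?] /andP[? ?]; lra.
have [k tk kt] := dyadic_scale tau0 tau1.
have := young_rate A0 e0 eta0 (ltW tau0) (levy_modulus_rate n4 eta0 etaE (ltW tau0) kt).
rewrite real_normK ?num_real//; apply: le_trans.
have -> : n%:R `^ (- (1 / 2)) = Num.sqrt n%:R^-1 :> R.
  by rewrite powRN div1r powR12_sqrt ?ler0n// sqrtrV.
rewrite [in leRHS]sqrtrM ?divr_ge0// mulrA mulrC.
by rewrite ler_wpM2r ?sqrtr_ge0// zA.
Qed.

End modulus_rate.

Lemma measurable_abs_ge {R : realType} {d : measure_display} {T : measurableType d}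
    (X : T -> R) (x : R) : measurable_fun setT X -> measurable [set w | x <= `|X w|]%R.
Proof.
move=> mX; have mN : measurable_fun setT (fun w => `|X w|) by exact: measurableT_comp.
rewrite (_ : [set w | _] = setT `&` (fun w => `|X w|) @^-1` `[x, +oo[%classic).
  by apply: mN; [exact: measurableT|exact: measurable_itv].
by rewrite setTI; apply/seteqP; split => w; rewrite /= in_itv/= andbT.
Qed.

Section levy_event.
Context {R : realType}.

(** The factor [D] and the rate [kappa] leave room for increments that are not centred
    and for changes of the time scale. *)
Definition sub_gaussian_increments {d : measure_display} {T : measurableType d}
    (P : probability T R) (J : set R) (D kappa : R) (Z : R -> T -> R) :=
  forall s t y : R, J s -> J t -> s != t -> 0 <= y ->
    (P [set w | y * Num.sqrt `|s - t| <= `|Z s w - Z t w|]%R <=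
      (D * expR (- (kappa * y ^+ 2)))%:E)%E.

(** One of the [2 ^ k] increments at level [k] exceeds [M * levy_modulus k], that is
    [M * sqrt (k + 1)] times its scale, with probability at most [D * rho ^ (k + 1)] where
    [rho = expR (- kappa * M ^ 2)].  With [rho <= 1 / 4] the union bound is summable over
    the levels, and [rho] is small enough for the sum to be at most [e]. *)
Lemma levy_event (D kappa e : R) : 0 < D -> 0 < kappa -> 0 < e ->
  exists2 M : R, 0 <= M &
  forall (d : measure_display) (T : measurableType d) (P : probability T R) (Z : R -> T -> R),
    (forall t, t \in `[0, 1] -> measurable_fun setT (Z t)) ->
    sub_gaussian_increments P `[0, 1]%classic D kappa Z ->
    exists A : set T, [/\ measurable A, (P A <= e%:E)%E & forall w, ~ A w ->
      forall k j, (j < 2 ^ k)%N ->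
       `|Z (j.+1%:R / (2 ^ k)%:R) w - Z (j%:R / (2 ^ k)%:R) w| <= M * levy_modulus k].
Proof.
move=> D0 k0 e0.
pose rho := Num.min (1 / 4) (e / (2 * D)).
have rho0 : 0 < rho by rewrite lt_min !divr_gt0// mulr_gt0.
have rho4 : rho <= 1 / 4 by rewrite ge_min lexx.
have rhoD : D * rho <= e / 2.
  have : rho <= e / (2 * D) by rewrite ge_min lexx orbT.
  rewrite ler_pdivlMr ?mulr_gt0//; lra.
have lrho : 0 <= - ln rho / kappa.
  by rewrite divr_ge0 ?(ltW k0)// oppr_ge0 ln_le0//; lra.
pose M := Num.sqrt (- ln rho / kappa).
have M2 : kappa * M ^+ 2 = - ln rho by rewrite sqr_sqrtr// mulrC divfK// gt_eqF.
exists M => [|d T P Z mZ Ztail]; first exact: sqrtr_ge0.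
have p2 m : (0 : R) < (2 ^ m)%:R by rewrite ltr0n expn_gt0.
have grid k j : (j <= 2 ^ k)%N -> j%:R / (2 ^ k)%:R \in `[0 : R, 1].
  by move=> jk; rewrite in_itv/= divr_ge0// ler_pdivrMr// mul1r ler_nat.
pose X k j w := Z (j.+1%:R / (2 ^ k)%:R) w - Z (j%:R / (2 ^ k)%:R) w.
pose E k j : set T := [set w | M * levy_modulus k <= `|X k j w|].
have mX k j : (j < 2 ^ k)%N -> measurable_fun setT (X k j).
  move=> jk; apply: measurable_funB; apply: mZ; apply: grid => //; exact: ltnW.
have mE k j : (j < 2 ^ k)%N -> measurable (E k j).
  by move=> jk; apply: measurable_abs_ge; exact: mX.
have PE k j : (j < 2 ^ k)%N -> (P (E k j) <= (D * rho ^+ k.+1)%:E)%E.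
  move=> jk.
  have ne : j.+1%:R / (2 ^ k)%:R != j%:R / (2 ^ k)%:R :> R.
    by rewrite (inj_eq (mulIf _)) ?eqr_nat ?gtn_eqF// invr_eq0 gt_eqF.
  have := Ztail (j.+1%:R / (2 ^ k)%:R) (j%:R / (2 ^ k)%:R) (M * Num.sqrt k.+1%:R)
    (grid _ _ jk) (grid _ _ (ltnW jk)) ne (mulr_ge0 (sqrtr_ge0 _) (sqrtr_ge0 _)).
  rewrite -mulrBl -natrB// subSn// subnn mul1r (ger0_norm (_ : 0 <= _^-1)) ?invr_ge0 ?ler0n//.
  have -> : expR (- (kappa * (M * Num.sqrt k.+1%:R) ^+ 2)) = rho ^+ k.+1.
    rewrite exprMn [Num.sqrt k.+1%:R ^+ 2]sqr_sqrtr// mulrA M2 -mulNr opprK mulrC.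
    by rewrite expRM_natl lnK.
  have -> : M * Num.sqrt k.+1%:R * Num.sqrt (2 ^ k)%:R^-1 = M * levy_modulus k.
    by rewrite -mulrA -sqrtrM.
  exact.
pose F k := \big[setU/set0]_(j < 2 ^ k) E k j.
have mF k : measurable (F k).
  by apply: bigsetU_measurable => j _; apply: mE.
have PF k : (P (F k) <= (e / (2 ^ k.+1)%:R)%:E)%E.
  apply: (le_trans (le_mu_bigsetU P _)); first by move=> j jk; exact: mE.
  apply: (@le_trans _ _ (\sum_(j < 2 ^ k) (D * rho ^+ k.+1)%:E)%E).
    by apply: lee_sum => j _; exact: PE.
  rewrite sumEFin lee_fin sumr_const card_ord -[leLHS]mulr_natl.
  have rk : rho ^+ k <= (2 ^ k)%:R^-1 * (2 ^ k)%:R^-1.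
    rewrite -invfM -natrM -expnMn natrX -exprVn.
    by apply: lerXn2r; rewrite ?nnegrE ?invr_ge0 ?(ltW rho0)//; lra.
  rewrite exprS expnS natrM invfM (mulrA e).
  have -> : (2 ^ k)%:R * (D * (rho * rho ^+ k)) = (D * rho) * ((2 ^ k)%:R * rho ^+ k) by ring.
  apply: ler_pM => //; rewrite ?mulr_ge0 ?exprn_ge0 ?(ltW D0) ?(ltW rho0) ?ler0n//.
  apply: (@le_trans _ _ ((2 ^ k)%:R * ((2 ^ k)%:R^-1 * (2 ^ k)%:R^-1))).
    exact: ler_wpM2l.
  by rewrite mulrA divff ?mul1r// gt_eqF.
exists (\bigcup_k F k); split.
- exact: bigcupT_measurable.
- apply: (@le_trans _ _ (\sum_(0 <= k <oo) P (F k))%E).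
    by apply: measure_sigma_subadditive => //; exact: bigcupT_measurable.
  apply: (@le_trans _ _ (\sum_(0 <= k <oo) (e / (2 ^ k.+1)%:R)%:E)%E).
    by apply: lee_nneseries.
  by apply: epsilon_trick0; exact: ltW.
- move=> w wA k j jk; rewrite leNgt; apply/negP => /ltW H; apply: wA.
  exists k => //; rewrite /F -bigcup_mkord; exists j => //.
Qed.

End levy_event.

(** * Increments of Brownian motion and of the Brownian bridge *)

Section gaussian.
Context {R : realType}.

(** The density of [N(m, s^2)] is at most [2 expR (- x^2 / (4 s^2))] times that of
    [N(m, (2 s)^2)] at distance at least [x] from [m], and the latter has mass one. *)
Lemma normal_prob_tail (m s x : R) : 0 < s -> 0 <= x ->
  (normal_prob m s [set z | x <= `|z - m|]%R <= (2 * expR (- (x ^+ 2 / (4 * s ^+ 2))))%:E)%E.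
Proof.
move=> s0 x0; set V := [set z | _].
have sn0 : s != 0 by rewrite gt_eqF.
have s20 : 2 * s != 0 by rewrite mulf_neq0.
set c := 2 * expR _.
have c0 : 0 <= c by rewrite mulr_ge0 ?expR_ge0.
have mV : measurable V.
  by apply: (@measurable_abs_ge _ _ _ (fun z : R => z - m)); exact: measurable_funB.
have pdfle z : V z -> normal_pdf m s z <= c * normal_pdf m (2 * s) z.
  rewrite /V /= => xz.
  rewrite !normal_pdfE// /normal_fun.
  have -> : normal_peak (2 * s) = normal_peak s / 2.
    rewrite /normal_peak -invfM; congr (_^-1).
    have -> : (2 * s) ^+ 2 * pi *+ 2 = 2 ^+ 2 * (s ^+ 2 * pi *+ 2) by ring.
    by rewrite sqrtrM ?sqr_ge0// sqrtr_sqr ger0_norm// mulrC.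
  rewrite /c (_ : 2 * _ * (_ / 2 * _) = normal_peak s * (expR (- (x ^+ 2 / (4 * s ^+ 2))) *
     expR (- (z - m) ^+ 2 / ((2 * s) ^+ 2 *+ 2)))); last by field.
  rewrite ler_wpM2l ?normal_peak_ge0// -expRD ler_expR.
  have zx : x ^+ 2 <= (z - m) ^+ 2.
    by rewrite -[leRHS]real_normK ?num_real// ler_pXn2r ?nnegrE.
  have -> : - (z - m) ^+ 2 / (s ^+ 2 *+ 2) = - (z - m) ^+ 2 / s ^+ 2 / 2 by field.
  have -> : - (x ^+ 2 / (4 * s ^+ 2)) + - (z - m) ^+ 2 / ((2 * s) ^+ 2 *+ 2) =
     - x ^+ 2 / s ^+ 2 / 4 - (z - m) ^+ 2 / s ^+ 2 / 8 by field.
  have : x ^+ 2 / s ^+ 2 <= (z - m) ^+ 2 / s ^+ 2.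
    by rewrite ler_pM2r ?invr_gt0 ?exprn_gt0.
  have : 0 <= x ^+ 2 / s ^+ 2 by rewrite divr_ge0 ?sqr_ge0.
  rewrite !mulNr; lra.
have mpdf s' (A : set R) : measurable_fun A (fun z => (normal_pdf m s' z)%:E).
  by apply/measurable_EFinP; apply: measurable_funTS; exact: measurable_normal_pdf.
rewrite /normal_prob.
apply: (@le_trans _ _ (\int[lebesgue_measure]_(z in V) (c%:E * (normal_pdf m (2 * s) z)%:E))%E).
  apply: ge0_le_integral => //.
  - by move=> z _; rewrite lee_fin normal_pdf_ge0.
  - exact: mpdf.
  - by apply: emeasurable_funM; [exact: measurable_cst|exact: mpdf].
rewrite ge0_integralZl_EFin//; last 2 first.
- by move=> z _; rewrite lee_fin normal_pdf_ge0.
- exact: mpdf.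
rewrite -[leRHS]mule1 lee_wpmul2l ?lee_fin//.
rewrite -(integral_normal_pdf m (2 * s)).
apply: ge0_subset_integral => //; first exact: mpdf.
by move=> z _; rewrite lee_fin normal_pdf_ge0.
Qed.

(** A law with a large standard deviation cannot put much mass near zero; this will bound
    the standard deviation from a tail estimate. *)
Lemma normal_prob_itv_le (m s r : R) : 0 < s -> 0 <= r ->
  (normal_prob m s [set z | `|z| < r]%R <= (2 * r / s)%:E)%E.
Proof.
move=> s0 r0; have sn0 : s != 0 by rewrite gt_eqF.
have -> : [set z : R | `|z| < r]%R = `]-r, r[%classic.
  by apply/seteqP; split => z; rewrite /= in_itv/= ltr_norml.
rewrite /normal_prob.
apply: (@le_trans _ _ (\int[lebesgue_measure]_(z in `](- r)%R, r[) cst (s^-1)%:E z)%E).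
  apply: ge0_le_integral => //.
  - by move=> z _; rewrite lee_fin normal_pdf_ge0.
  - by apply/measurable_EFinP; apply: measurable_funTS; exact: measurable_normal_pdf.
  - move=> z _; rewrite lee_fin; apply: (le_trans (normal_pdf_ub _ _ sn0)).
    rewrite /normal_peak lef_pV2 ?posrE//; last first.
      by rewrite sqrtr_gt0 mulrn_wgt0// mulr_gt0 ?pi_gt0// exprn_gt0.
    rewrite -{1}(gtr0_norm s0) -sqrtr_sqr ler_sqrt; last first.
      by rewrite mulrn_wge0// mulr_ge0 ?pi_ge0// sqr_ge0.
    have : 1 <= pi :> R by rewrite (le_trans _ (pi_ge2 R))// ler1n.
    have : 0 <= s ^+ 2 by rewrite sqr_ge0.
    rewrite mulr2n; nra.
rewrite integral_cst; last exact: measurable_itv.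
rewrite [X in (_ * X)%E]lebesgue_measure_itv/= lte_fin; case: ltP => rr; last first.
  by rewrite mule0 lee_fin divr_ge0 ?mulr_ge0// ltW.
by rewrite -EFinB -EFinM lee_fin le_eqVlt; apply/orP; left; apply/eqP; ring.
Qed.

Lemma normal_law_tail {d : measure_display} {T : measurableType d} (P : probability T R)
    (X : T -> R) (m s S x : R) : measurable_fun setT X ->
  has_normal_law P X m s -> 0 <= s -> s <= S -> 0 < S -> 0 <= x ->
  (P [set w | x <= `|X w - m|]%R <= (2 * expR (- (x ^+ 2 / (4 * S ^+ 2))))%:E)%E.
Proof.
move=> mX lawX s0 sS S0 x0; pose V := [set z | x <= `|z - m|]%R.
have mV : measurable V.
  by apply: (@measurable_abs_ge _ _ _ (fun z : R => z - m)); exact: measurable_funB.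
have -> : [set w | x <= `|X w - m|]%R = X @^-1` V by [].
rewrite lawX//; case: ifPn => [_|sn0].
  rewrite diracE; have [xE|xn0] := eqVneq x 0.
    rewrite xE expr0n/= mul0r oppr0 expR0 mulr1 lee_fin.
    by case: (_ \in _); rewrite ?ler1n ?ler0n.
  rewrite memNset ?lee_fin ?mulr_ge0 ?expR_ge0//.
  by rewrite /V /= subrr normr0 => xle; move: xn0; rewrite eq_le xle x0.
have sp : 0 < s by rewrite lt_neqAle eq_sym sn0.
apply: (le_trans (normal_prob_tail m sp x0)).
rewrite lee_fin ler_pM2l// ler_expR lerN2 ler_wpM2l ?sqr_ge0//.
by rewrite lef_pV2 ?posrE ?mulr_gt0 ?exprn_gt0// ler_pM2l// ler_pXn2r ?nnegrE// ltW.
Qed.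

End gaussian.

Section brownian_increments.
Context {R : realType} {d : measure_display} {T : measurableType d} (P : probability T R).

Lemma chebyshev_second_moment (Y : T -> R) (v : R) : measurable_fun setT Y -> 0 < v ->
  (\int[P]_w (Y w ^+ 2)%:E <= v%:E)%E ->
  (P [set w | 2 * Num.sqrt v <= `|Y w|]%R <= (1 / 4)%:E)%E.
Proof.
move=> mY v0 intY; set V := [set w | _].
have mV : measurable V by exact: measurable_abs_ge.
have mY2 (A : set T) : measurable_fun A (fun w => (Y w ^+ 2)%:E).
  by apply/measurable_EFinP; apply: measurable_funTS; exact: measurable_funX.
have : ((4 * v)%:E * P V <= v%:E)%E.
  rewrite -(integral_cst P mV); apply: le_trans intY.
  apply: (@le_trans _ _ (\int[P]_(w in V) (Y w ^+ 2)%:E)%E).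
    apply: ge0_le_integral => //.
    - by move=> w _; rewrite lee_fin mulr_ge0// ltW.
    - move=> w; rewrite /V /= => Vw; rewrite lee_fin.
      have -> : 4 * v = (2 * Num.sqrt v) ^+ 2.
        by rewrite exprMn sqr_sqrtr ?(ltW v0)//; ring.
      by rewrite -[leRHS]real_normK ?num_real// ler_pXn2r ?nnegrE ?mulr_ge0 ?sqrtr_ge0.
  apply: ge0_subset_integral => //.
  by move=> w _; rewrite lee_fin sqr_ge0.
have PV : P V \is a fin_num by exact: fin_num_measure.
rewrite -(fineK PV) -EFinM !lee_fin => H.
rewrite ler_pdivlMr//; nra.
Qed.

Lemma brownian_motion_sub_gaussian (J : set R) (W : R -> {RV P >-> R}) :
  standard_brownian_motion P J W ->
  sub_gaussian_increments P J 2 (1 / 4) (fun t w => W t w).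
Proof.
move=> [_ _ lawW _].
have main s t y : J s -> J t -> s < t -> 0 <= y ->
   (P [set w | y * Num.sqrt (t - s) <= `|W t w - W s w|]%R <= (2 * expR (- (1 / 4 * y ^+ 2)))%:E)%E.
  move=> Js Jt st y0.
  have ts0 : 0 < t - s by rewrite subr_gt0.
  have sq0 : 0 < Num.sqrt (t - s) by rewrite sqrtr_gt0.
  have mX : measurable_fun setT (W t \- W s) by exact: measurable_funB.
  have := normal_law_tail mX (lawW s t Js Jt (ltW st)) (sqrtr_ge0 _) (lexx _) sq0
    (mulr_ge0 y0 (sqrtr_ge0 (t - s))).
  under eq_set do rewrite subr0.
  have -> : (y * Num.sqrt (t - s)) ^+ 2 / (4 * Num.sqrt (t - s) ^+ 2) = 1 / 4 * y ^+ 2.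
    by field; rewrite gt_eqF.
  exact.
move=> s t y Js Jt st y0; have [st'|ts] := ltP s t.
  rewrite ltr0_norm ?subr_lt0// opprB.
  have -> : [set w | y * Num.sqrt (t - s) <= `|W s w - W t w|]%R =
      [set w | y * Num.sqrt (t - s) <= `|W t w - W s w|]%R.
    by apply/seteqP; split => w /=; rewrite distrC.
  exact: main.
rewrite ger0_norm ?subr_ge0//; apply: main => //.
by rewrite lt_neqAle eq_sym st.
Qed.

(** Only the second moment of [Y] is known.  With [q = Num.sqrt tau], Chebyshev's
    inequality puts mass [3 / 4] on [`|Y| < 2 * q], where a normal law has mass at most
    [4 * q / s]; so [s <= 6 * q].  At distance [24 * q] from the mean or more there
    is mass at most [2 / 5], so some value of [Y] is closer and has [`|Y| < 2 * q], whence
    [`|m| <= 26 * q].  For [y >= 52] the mean takes at most half of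
    [y * q], and for smaller [y] the factor [expR 5] makes the bound trivial. *)
Lemma gaussian_sub_gaussian (Y : T -> R) (m s tau y : R) : measurable_fun setT Y ->
  has_normal_law P Y m s -> 0 <= s -> 0 < tau -> 0 <= y ->
  (\int[P]_w (Y w ^+ 2)%:E <= tau%:E)%E ->
  (P [set w | y * Num.sqrt tau <= `|Y w|]%R <=
    (2 * expR 5 * expR (- (1 / 576 * y ^+ 2)))%:E)%E.
Proof.
move=> mY lawY s0 tau0 y0 intY; set q := Num.sqrt tau.
have q0 : 0 < q by rewrite sqrtr_gt0.
have cheb := chebyshev_second_moment mY tau0 intY.
pose V1 := [set w | 2 * q <= `|Y w|]%R.
have mV1 : measurable V1 by exact: measurable_abs_ge.
have PV1 : P V1 \is a fin_num by exact: fin_num_measure.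
have s6 : s <= 6 * q.
  have [s_eq0|sn0] := eqVneq s 0; first by rewrite s_eq0 mulr_ge0// ltW.
  have sp : 0 < s by rewrite lt_neqAle eq_sym sn0.
  have := @normal_prob_itv_le R m s (2 * q) sp (mulr_ge0 (ler0n _ 2) (ltW q0)).
  have mB : measurable [set z : R | `|z| < 2 * q]%R.
    rewrite (_ : mkset _ = `](- (2 * q))%R, (2 * q)%R[%classic); first exact: measurable_itv.
    by apply/seteqP; split => z; rewrite /= in_itv/= ltr_norml.
  have := lawY _ mB; rewrite (negbTE sn0) => <-.
  have -> : Y @^-1` [set z : R | `|z| < 2 * q]%R = ~` V1.
    by apply/seteqP; split => w; rewrite /V1 /= ltNge => /negP.
  rewrite probability_setC// -(fineK PV1) -EFinB lee_fin.
  move: cheb; rewrite -/q -/V1 -(fineK PV1) lee_fin => c1 c2.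
  have : 3 / 4 <= 2 * (2 * q) / s by lra.
  rewrite ler_pdivlMr//; lra.
have S0 : 0 < 6 * q by rewrite mulr_gt0.
have tail x (x0 : 0 <= x) := normal_law_tail mY lawY s0 s6 S0 x0.
have m26 : `|m| <= 26 * q.
  pose V2 := [set w | 24 * q <= `|Y w - m|]%R.
  have mV2 : measurable V2.
    by apply: measurable_abs_ge; exact: measurable_funB.
  have PV2 : P V2 \is a fin_num by exact: fin_num_measure.
  have P2 : (P V2 <= (2 / 5)%:E)%E.
    apply: (le_trans (tail (24 * q) _)); first by rewrite mulr_ge0// ltW.
    have -> : (24 * q) ^+ 2 / (4 * (6 * q) ^+ 2) = 4 by field; rewrite gt_eqF.
    rewrite lee_fin ler_pM2l// expRN lef_pV2 ?posrE ?expR_gt0//.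
    by have := expR_ge1Dx (4 : R); lra.
  have [w [w1 w2]] : exists w, ~ V1 w /\ ~ V2 w.
    apply: contrapT => /forallNP H.
    have : (P (V1 `|` V2) <= P V1 + P V2)%E by exact: measureU2.
    have -> : V1 `|` V2 = setT.
      apply/seteqP; split => // w _; have [V1w|V1w] := pselect (V1 w); first by left.
      by right; apply: contrapT => V2w; exact: (H w).
    rewrite probability_setT.
    move: cheb P2; rewrite -/q -/V1 -(fineK PV1) -(fineK PV2) -EFinD !lee_fin; lra.
  move/negP : w1; rewrite /V1 /= -ltNge => w1.
  move/negP : w2; rewrite /V2 /= -ltNge => w2.
  have := ler_distD (Y w) m 0; rewrite subr0 (distrC m) subr0.
  lra.
have [y52|y52] := leP 52 y.
  apply: (@le_trans _ _ (P [set w | y * q / 2 <= `|Y w - m|]%R)).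
    apply: le_measure; rewrite ?inE; [exact: measurable_abs_ge| |].
      by apply: measurable_abs_ge; exact: measurable_funB.
    move=> w /= yY; have := ler_distD m (Y w) 0; rewrite !subr0.
    nra.
  apply: (le_trans (tail _ _)); first by rewrite !mulr_ge0// ltW.
  have -> : (y * q / 2) ^+ 2 / (4 * (6 * q) ^+ 2) = 1 / 576 * y ^+ 2.
    by field; rewrite gt_eqF.
  rewrite lee_fin ler_wpM2r ?expR_ge0// ler_peMr//.
  by have := expR_ge1Dx (5 : R); lra.
apply: (le_trans (probability_le1 _ _)); first exact: measurable_abs_ge.
rewrite lee_fin -mulrA -expRD.
have y2 : y ^+ 2 <= 2704 by rewrite expr2; nra.
by have := expR_ge1Dx (5 - 1 / 576 * y ^+ 2); lra.
Qed.

End brownian_increments.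

Section brownian_bridge_increments.
Context {R : realType} {d : measure_display} {T : measurableType d} (P : probability T R).

Lemma covariance_centered (X Y : T -> R) : ('E_P[X] = 0)%E -> ('E_P[Y] = 0)%E ->
  covariance P X Y = (\int[P]_w (X w * Y w)%:E)%E.
Proof.
move=> X0 Y0; rewrite covariance.unlock X0 Y0 expectation.unlock.
by apply: eq_integral => w _; rewrite !fctE/= !subr0.
Qed.

Lemma second_moment_diff (X Y : T -> R) (p q r : R) :
  measurable_fun setT X -> measurable_fun setT Y ->
  (\int[P]_w (X w * X w)%:E)%E = p%:E ->
  (\int[P]_w (X w * Y w)%:E)%E = q%:E ->
  (\int[P]_w (Y w * Y w)%:E)%E = r%:E ->
  (\int[P]_w ((X w - Y w) ^+ 2)%:E)%E = (p - 2 * q + r)%:E.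
Proof.
move=> mX mY intXX intXY intYY.
have mM (U V : T -> R) : measurable_fun setT U -> measurable_fun setT V ->
    measurable_fun setT (fun w => (U w * V w)%:E).
  by move=> mU mV; apply/measurable_EFinP; exact: measurable_funM.
have integrable_square (U : T -> R) u : measurable_fun setT U ->
    (\int[P]_w (U w * U w)%:E)%E = u%:E -> P.-integrable setT (fun w => (U w * U w)%:E).
  move=> mU intU; apply/integrableP; split; first exact: mM.
  rewrite (eq_integral (fun w => (U w * U w)%:E)) ?intU ?ltry// => w _.
  by rewrite abse_EFin ger0_norm// -expr2 sqr_ge0.
have iXX := integrable_square _ _ mX intXX.
have iYY := integrable_square _ _ mY intYY.
have iXY : P.-integrable setT (fun w => (X w * Y w)%:E).
  apply: le_integrable (integrableD measurableT iXX iYY); [exact: measurableT|exact: mM|].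
  move=> w _; rewrite -EFinD !abse_EFin lee_fin.
  rewrite (ger0_norm (_ : 0 <= X w * X w + _)); last by rewrite addr_ge0// -expr2 sqr_ge0.
  have := sqr_ge0 (X w - Y w); have := sqr_ge0 (X w + Y w).
  by rewrite ler_norml; nra.
have i2XY := integrableZl measurableT (- 2) iXY.
have i3 := integrableD measurableT iXX i2XY.
transitivity (\int[P]_w ((X w * X w)%:E + (- 2)%:E * (X w * Y w)%:E + (Y w * Y w)%:E))%E.
  by apply: eq_integral => w _; rewrite -EFinM -!EFinD; congr EFin; ring.
rewrite integralD// integralD// integralZl//.
by rewrite intXX intXY intYY -EFinM -!EFinD; congr EFin; ring.
Qed.

(** Since the covariance determines the second moments, an increment over a lag
    [r] has second moment [r (1 - r) <= r]. *)
Lemma brownian_bridge_sub_gaussian (X : R -> {RV P >-> R}) :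
  standard_brownian_bridge P X ->
  sub_gaussian_increments P `[0, 1]%classic (2 * expR 5) (1 / 576) (fun t w => X t w).
Proof.
move=> [gX _ meanX covX] s t y s01 t01 st y0.
have tau0 : 0 < `|s - t| by rewrite normr_gt0 subr_eq0.
have [m [sg [sg0]]] := gX 2 (fun i => if i == ord0 then s else t)
   (fun i => if i == ord0 then 1 else - 1) (fun i => if i == ord0 as b return
      `[0, 1]%classic (if b then s else t) then s01 else t01).
have -> : (fun w => \sum_(i < 2) (if i == ord0 then 1 else -1) *
    X (if i == ord0 then s else t) w) = (fun w => X s w - X t w).
  by apply/funext => w; rewrite !big_ord_recl big_ord0/= addr0 mul1r mulN1r.
move=> lawX.
have mD : measurable_fun setT (fun w => X s w - X t w) by exact: measurable_funB.
apply: (gaussian_sub_gaussian mD lawX sg0 tau0 y0).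
have cov u v (u01 : u \in `[0, 1]) (v01 : v \in `[0, 1]) :
    (\int[P]_w (X u w * X v w)%:E)%E = (Num.min u v - u * v)%:E.
  by rewrite -covariance_centered ?meanX// covX.
rewrite (second_moment_diff _ _ (cov _ _ s01 s01) (cov _ _ s01 t01) (cov _ _ t01 t01));
  [|exact: measurable_funPT..].
rewrite lee_fin !minxx.
have := sqr_ge0 (s - t).
have [st'|ts] := ltP s t; [rewrite ltr0_norm ?subr_lt0//|rewrite ger0_norm ?subr_ge0//]; nra.
Qed.

Lemma sub_gaussian_increments_weaken (J J' : set R) (D D' k k' : R) (Z : R -> T -> R) :
  J' `<=` J -> 0 <= D -> D <= D' -> k' <= k ->
  sub_gaussian_increments P J D k Z -> sub_gaussian_increments P J' D' k' Z.
Proof.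
move=> JJ D0 DD kk sZ s t y Js Jt st y0.
apply: (le_trans (sZ s t y (JJ _ Js) (JJ _ Jt) st y0)).
by rewrite lee_fin ler_pM ?expR_ge0// ler_expR lerN2 ler_wpM2r// sqr_ge0.
Qed.

Lemma sub_gaussian_increments_eq (J : set R) (D k : R) (Z Z' : R -> T -> R) :
  (forall t w, J t -> Z' t w = Z t w) ->
  sub_gaussian_increments P J D k Z -> sub_gaussian_increments P J D k Z'.
Proof.
move=> ZZ sZ s t y Js Jt st y0.
rewrite (_ : mkset _ = [set w | y * Num.sqrt `|s - t| <= `|Z s w - Z t w|]%R).
  exact: sZ.
by apply/funext => w /=; rewrite !ZZ.
Qed.

(** A Lipschitz time change only rescales the time lags. *)
Lemma sub_gaussian_increments_time_change (J J' : set R) (D k c : R) (phi : R -> R)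
    (Z : R -> T -> R) : 1 <= D -> 0 < k -> 0 < c ->
  (forall t, J t -> J' (phi t)) ->
  (forall s t, J s -> J t -> `|phi s - phi t| <= c * `|s - t|) ->
  (forall t, J' t -> measurable_fun setT (Z t)) ->
  sub_gaussian_increments P J' D k Z ->
  sub_gaussian_increments P J D (k / c) (fun t => Z (phi t)).
Proof.
move=> D1 k0 c0 JJ lip mZ sZ s t y Js Jt st y0.
have st0 : 0 < `|s - t| by rewrite normr_gt0 subr_eq0.
have [pst|pst] := eqVneq (phi s) (phi t).
  have [->|y1] := eqVneq y 0.
    apply: (le_trans (probability_le1 _ _)).
      by apply: measurable_abs_ge; apply: measurable_funB; apply: mZ; exact: JJ.
    by rewrite expr0n/= mulr0 oppr0 expR0 mulr1 lee_fin.
  rewrite (_ : mkset _ = set0).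
    by rewrite measure0 lee_fin mulr_ge0 ?expR_ge0//; lra.
  apply/seteqP; split => w //=; rewrite pst subrr normr0 leNgt.
  by rewrite mulr_gt0 ?sqrtr_gt0// lt_neqAle eq_sym y1.
have sc : 0 < Num.sqrt c by rewrite sqrtr_gt0.
have y0' : 0 <= y / Num.sqrt c by rewrite divr_ge0// ltW.
have := sZ _ _ _ (JJ _ Js) (JJ _ Jt) pst y0'.
have -> : k * (y / Num.sqrt c) ^+ 2 = k / c * y ^+ 2.
  by rewrite expr_div_n sqr_sqrtr ?(ltW c0)//; field; rewrite gt_eqF.
apply: le_trans; apply: le_measure; rewrite ?inE;
  [by apply: measurable_abs_ge; apply: measurable_funB; apply: mZ; exact: JJ..|].
move=> w /=; apply: le_trans.
rewrite -mulrA ler_wpM2l// ler_pdivrMl// -sqrtrM ?(ltW c0)//.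
by rewrite ler_sqrt ?mulr_ge0 ?(ltW c0)//; exact: lip.
Qed.

Lemma ae_off_null (Q : T -> Prop) : {ae P, forall w, Q w} ->
  exists N : set T, [/\ measurable N, P N = 0%E & forall w, ~ N w -> Q w].
Proof.
move=> [N [mN N0 NQ]]; exists N; split => // w Nw.
by apply: contrapT => nQ; apply: Nw; exact: NQ.
Qed.

Lemma brownian_path_regularity (u v : R) (B : R -> T -> R) :
  brownian_motion_on P u v B \/ brownian_bridge_on P u v B ->
  [/\ forall t, t \in `[u, v] -> measurable_fun setT (B t),
      sub_gaussian_increments P `[u, v]%classic (2 * expR 5) (1 / 576) B &
      exists N : set T, [/\ measurable N, P N = 0%E & forall w, ~ N w ->
        {within `[u, v], continuous (fun t => B t w)}]].
Proof.
have D2 : 2 <= 2 * expR 5 :> R by have := expR_ge1Dx (5 : R); lra.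
have path_eq (X : R -> T -> R) (J : set R) w : `[u, v]%classic `<=` J ->
    (forall t, t \in `[u, v] -> B t w = X t w) ->
    {within J, continuous (fun t => X t w)} -> {within `[u, v], continuous (fun t => B t w)}.
  move=> uvJ BX cX.
  have XB : {in `[u, v]%classic, (fun t => X t w) =1 (fun t => B t w)}.
    by move=> t; rewrite inE => tuv; rewrite BX.
  exact: (subspace_eq_continuous XB (continuous_subspaceW uvJ cX)).
case=> [[J [W [_ J0 uvJ bW BW]]]|[uv01 [X [bX BX]]]].
- split => [t tuv||].
  + by rewrite (_ : B t = W t); [exact: measurable_funPT|apply/funext => w; exact: BW].
  + apply: (sub_gaussian_increments_eq (fun t w tuv => BW t w tuv)).
    apply: sub_gaussian_increments_weaken (brownian_motion_sub_gaussian bW) => //; lra.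
  + have [_ cW _ _] := bW; have [N [mN N0 NW]] := ae_off_null cW.
    exists N; split => // w Nw.
    exact: (path_eq (fun t w => W t w) J w uvJ (fun t => BW t w) (NW w Nw)).
- split => [t tuv||].
  + by rewrite (_ : B t = X t); [exact: measurable_funPT|apply/funext => w; exact: BX].
  + apply: (sub_gaussian_increments_eq (fun t w tuv => BX t w tuv)).
    apply: sub_gaussian_increments_weaken (brownian_bridge_sub_gaussian bX) => //; lra.
  + have [_ cX _ _] := bX; have [N [mN N0 NX]] := ae_off_null cX.
    exists N; split => // w Nw.
    exact: (path_eq (fun t w => X t w) `[0, 1]%classic w uv01 (fun t => BX t w) (NX w Nw)).
Qed.

End brownian_bridge_increments.

(** * Brownian noise at the clock [L] *)

Section time_changed_modulus.
Context {R : realType}.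

Lemma lipschitz_comp_within_continuous (J J' : set R) (c : R) (phi z : R -> R) : 0 < c ->
  (forall t, J t -> J' (phi t)) ->
  (forall s t, J s -> J t -> `|phi s - phi t| <= c * `|s - t|) ->
  {within J', continuous z} -> {within J, continuous (z \o phi)}.
Proof.
move=> c0 JJ lip /subspace_continuousP cz; apply/subspace_continuousP => t Jt.
have /cvgrPdist_le H := cz _ (JJ _ Jt); apply/cvgrPdist_le => e /H.
move=> /nbhs_ballP[d /= d0 Hd]; apply/nbhs_ballP; exists (d / c); first exact: divr_gt0.
move=> x; rewrite /ball /= ltr_pdivlMr// mulrC => tx Jx; apply: Hd; last exact: JJ.
by rewrite /ball/=; apply: le_lt_trans tx; exact: lip.
Qed.

(** The motion or bridge run at the clock [L] is sub-Gaussian again, so Levy's modulus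
    holds for it off a small event; Young's inequality then trades the square root of
    the lag for [eps (s - t)^2]. *)
Lemma time_changed_brownian_modulus (a b m e eps : R) (L dL : R -> R) : a < b ->
  is_derivative_on a b L dL -> {in `[a, b] &, {homo L : x y / x <= y}} ->
  (forall t, t \in `[a, b] -> dL t <= m) -> 0 <= m -> 0 < e -> 0 < eps ->
  exists2 C : R, 0 <= C &
  forall (d : measure_display) (T : measurableType d) (P : probability T R) (B : R -> T -> R),
    brownian_motion_on P (L a) (L b) B \/ brownian_bridge_on P (L a) (L b) B ->
    forall (n : nat) (eta : R), (4 <= n)%N -> 0 <= eta -> eta ^+ 3 = ln n%:R / n%:R ->
    exists A : set T, [/\ measurable A, (P A <= e%:E)%E & forall w, ~ A w ->
      forall s t, s \in `[a, b] -> t \in `[a, b] ->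
        n%:R `^ (- (1 / 2)) * `|B (L s) w - B (L t) w| <= eps * (s - t) ^+ 2 + C * eta ^+ 2].
Proof.
move=> ab LdL Lincr dLm m0 e0 eps0.
have ba0 : 0 < b - a by rewrite subr_gt0.
pose phi (r : R) := L (a + (b - a) * r); pose c := (m + 1) * (b - a).
have c0 : 0 < c by rewrite mulr_gt0// ltr_wpDl.
have aff r : r \in `[0, 1] -> a + (b - a) * r \in `[a, b].
  rewrite !in_itv/= => /andP[r0 r1]; apply/andP; split; first by rewrite lerDl mulr_ge0// ltW.
  by rewrite -lerBrDl ler_piMr// ltW.
have aab : a \in `[a, b] by rewrite in_itv/= lexx ltW.
have bab : b \in `[a, b] by rewrite in_itv/= lexx ltW.
have phiJ r : `[0, 1]%classic r -> `[L a, L b]%classic (phi r).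
  move=> /aff r01; have : a + (b - a) * r \in `[a, b] by [].
  by rewrite [in X in X -> _]in_itv/= in_itv/= => /andP[r1 r2]; rewrite !Lincr.
have phi_lip r q : `[0, 1]%classic r -> `[0, 1]%classic q -> `|phi r - phi q| <= c * `|r - q|.
  have main x y : `[0, 1]%classic x -> `[0, 1]%classic y -> x <= y ->
      `|phi y - phi x| <= c * `|y - x|.
    move=> /aff x01 /aff y01 xy.
    have axy : a + (b - a) * x <= a + (b - a) * y by rewrite lerD2l ler_wpM2l// ltW.
    have := lipschitz_of_derivative_le LdL dLm x01 y01 axy.
    rewrite ger0_norm ?subr_ge0 ?Lincr// ger0_norm ?subr_ge0//.
    by rewrite (_ : (m + 1) * _ = c * (y - x))// /c; ring.
  move=> r01 q01; have [rq|/ltW qr] := leP r q; last exact: main.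
  by rewrite distrC (distrC r); exact: main.
have D0 : (0 : R) < 2 * expR 5 by rewrite mulr_gt0 ?expR_gt0.
have D1 : (1 : R) <= 2 * expR 5 by have := expR_ge1Dx (5 : R); lra.
have k0 : (0 : R) < 1 / 576 by lra.
have [M M0 HM] := levy_event D0 (divr_gt0 k0 c0) e0.
(* [12] is the constant of [sum_levy_modulus], and [2 * 12 + 1] that of [chaining] *)
have M25 : 0 <= (2 * 12 + 1) * M by rewrite mulr_ge0.
have eps1 : 0 < eps * (b - a) ^+ 2 by rewrite mulr_gt0 ?exprn_gt0.
exists (rate_constant ((2 * 12 + 1) * M) (eps * (b - a) ^+ 2)); first exact: rate_constant_ge0.
move=> d T P B brB n eta n4 eta0 etaE.
have [mB sB [N [mN N0 NB]]] := brownian_path_regularity brB.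
have mZ r : r \in `[0, 1] -> measurable_fun setT (B (phi r)).
  by move=> r01; apply: mB; exact: phiJ.
have [A [mA PA HA]] := HM d T P (fun r => B (phi r)) mZ
  (sub_gaussian_increments_time_change D1 k0 c0 phiJ phi_lip mB sB).
exists (A `|` N); split; first exact: measurableU.
  by apply: (@le_trans _ _ (P A + P N)%E); [exact: measureU2|rewrite N0 adde0].
move=> w /not_orP[Aw Nw] s t sab tab.
have zc : {within `[0, 1]%classic, continuous ((fun t => B t w) \o phi)}.
  exact: (lipschitz_comp_within_continuous c0 phiJ phi_lip (NB w Nw)).
have summable k i : \sum_(j < i) M * levy_modulus (k + j) <= 12 * (M * levy_modulus k).
  by rewrite -mulr_sumr mulrCA ler_wpM2l// sum_levy_modulus.
have modB k x y : x \in `[0, 1] -> y \in `[0, 1] -> `|x - y| <= (2 ^ k)%:R^-1 ->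
    `|B (phi x) w - B (phi y) w| <= (2 * 12 + 1) * M * levy_modulus k.
  rewrite -mulrA; exact: (chaining zc (HA w Aw) summable).
have back x : x \in `[a, b] -> (x - a) / (b - a) \in `[0, 1].
  rewrite !in_itv/= => /andP[ax xb]; rewrite divr_ge0 ?subr_ge0 ?(ltW ab)//=.
  by rewrite ler_pdivrMr// mul1r lerD2r.
have backK x : a + (b - a) * ((x - a) / (b - a)) = x by field; rewrite gt_eqF.
have := modulus_rate n4 M25 eps1 eta0 etaE modB (back _ sab) (back _ tab).
rewrite /phi !backK (_ : eps * _ * _ = eps * (s - t) ^+ 2)//.
by field; rewrite gt_eqF.
Qed.

End time_changed_modulus.

(** * Extrema over a segment and kernels of bounded variation *)

Section sup_inf_on.
Context {R : realType}.
Implicit Types (a b m : R) (g : R -> R).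

Lemma inf_on_gt0 a b g : a <= b -> (0 < inf_on a b g)%E ->
  exists2 c : R, 0 < c & forall t, t \in `[a, b] -> c <= g t.
Proof.
move=> ab; have lb t : t \in `[a, b] -> (inf_on a b g <= (g t)%:E)%E.
  by move=> tab; apply: ereal_inf_lbound; exists t.
have := lb a; rewrite in_itv/= lexx ab => /(_ isT).
case: (inf_on a b g) lb => [c lb _ c0|//|//].
by exists c => // t /lb; rewrite lee_fin.
Qed.

Lemma sup_on_lty a b g : a <= b -> (sup_on a b g < +oo)%E ->
  exists m, forall t, t \in `[a, b] -> g t <= m.
Proof.
move=> ab; have ub t : t \in `[a, b] -> ((g t)%:E <= sup_on a b g)%E.
  by move=> tab; apply: ereal_sup_ubound; exists t.
have := ub a; rewrite in_itv/= lexx ab => /(_ isT).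
case: (sup_on a b g) ub => [m ub _ _|//|//].
by exists m => t /ub; rewrite lee_fin.
Qed.

Lemma abs_sup_on_le a b m g : (`|sup_on a b g| <= m%:E)%E ->
  forall t, t \in `[a, b] -> g t <= m.
Proof.
move=> gm t tab; rewrite -lee_fin; apply: le_trans gm; apply: (le_trans _ (lee_abs _)).
by apply: ereal_sup_ubound; exists t.
Qed.

Lemma le_abs_sup_on a b m g : a <= b -> (forall t, t \in `[a, b] -> 0 <= g t <= m) ->
  (`|sup_on a b g| <= m%:E)%E.
Proof.
move=> ab gm; have aab : a \in `[a, b] by rewrite in_itv/= lexx.
rewrite gee0_abs.
  by apply: ge_ereal_sup => _ [t tab <-]; rewrite lee_fin; have /andP[] := gm t tab.
apply: (@le_trans _ _ (g a)%:E); last by apply: ereal_sup_ubound; exists a.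
by rewrite lee_fin; have /andP[] := gm a aab.
Qed.

End sup_inf_on.

Section kernel.
Context {R : realType}.

(** The support condition says nothing at [1] and [-1], where continuity takes over. *)
Lemma vanish_at_boundary (k : R -> R) : continuous k ->
  (forall t, 1 < `|t| -> k t = 0) -> forall t, 1 <= `|t| -> k t = 0.
Proof.
move=> ck k0 t; rewrite le_eqVlt => /orP[/eqP t1|]; last exact: k0.
apply/eqP/negPn/negP => kt.
have kt0 : 0 < `|k t| by rewrite normr_gt0.
have /cvgrPdist_lt/(_ _ kt0) /nbhs_ballP[d /= d0 Hd] := ck t.
have := Hd (t + d / 2 * t); rewrite /ball/= opprD addNKr normrN normrM -t1 mulr1.
rewrite ger0_norm; last by rewrite divr_ge0// ltW.
have d2 : d / 2 < d by rewrite ltr_pdivrMr// ltr_pMr// ltr1n.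
move=> /(_ d2); rewrite (k0 (t + _)) ?subr0 ?ltxx//.
rewrite -[X in X + _]mul1r -mulrDl normrM -t1 mulr1 gtr0_norm; last by rewrite addr_gt0 ?divr_gt0.
by rewrite ltrDl divr_gt0.
Qed.

(** An integrable derivative makes the kernel of bounded variation; this is all that
    the integration by parts asks of it. *)
Lemma compact_support_dominated (k dk : R -> R) :
  (forall u, is_derive u (1 : R) k (dk u)) ->
  lebesgue_measure.-integrable setT (EFin \o dk) ->
  (forall u, 1 <= `|u| -> k u = 0) ->
  exists V v, dominated k V /\ forall x y, V y - V x <= v.
Proof.
move=> kdk dki k0.
have dki1 : lebesgue_measure.-integrable `[- 1, 1] (EFin \o dk).
  by apply: integrableS dki; [exact: measurableT|exact: measurable_itv|exact: subsetT].
have [G HG] := @monotone_domination R (- 1) 1 k dk (fun x _ => kdk x) dki1.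
have N11 : -1 <= 1 :> R by lra.
have [|domV VV] := dominated_clamp N11 HG.
  move=> u u1; apply: k0; have := ler_norm u; have := ler_norm (- u); rewrite normrN.
  by case: u1; lra.
by exists (G \o clamp (- 1) 1), (G 1 - G (- 1)).
Qed.

End kernel.

(** * The rates of the majorant and of the smoothed estimators *)

Section rates.
Context {R : realType}.

(** [eta ^ 2] is the rate sought, in the two forms in which it is written. *)
Lemma eta_rate (n : nat) : (4 <= n)%N -> exists2 eta : R, 0 <= eta &
  [/\ eta ^+ 3 = ln n%:R / n%:R,
      eta ^+ 2 = (n%:R^-1 * ln n%:R) `^ (2 / 3) &
      eta ^+ 2 = n%:R `^ (- (2 / 3)) * ln n%:R `^ (2 / 3)].
Proof.
move=> n4; have l1 := @ln_ge1 R n n4; have l0 : 0 <= ln n%:R :> R by lra.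
have n0 : 0 <= n%:R^-1 :> R by rewrite invr_ge0.
have nl0 : 0 <= n%:R^-1 * ln n%:R :> R by rewrite mulr_ge0.
pose eta : R := (n%:R^-1 * ln n%:R) `^ 3^-1.
have eta0 : 0 <= eta by rewrite powR_ge0.
have eta2 : eta ^+ 2 = (n%:R^-1 * ln n%:R) `^ (2 / 3).
  by rewrite -powR_mulrn// /eta -powRrM (mulrC 3^-1).
exists eta => //; split => //.
  by rewrite -powR_mulrn// /eta -powRrM mulVf// powRr1// mulrC.
by rewrite eta2 powRM// powRN -powR_inv1 ?ler0n// -powRrM mulN1r powRN.
Qed.

End rates.

Section majorant_rate.
Context {R : realType}.

(** The quadratic parts of the concavity of [F] and of the fluctuation bound on the noise
    [B] cancel, which leaves a line above [G]. *)
Lemma lcm_close_of_noise (a b c q r : R) (f F B G H : R -> R) : 0 < c ->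
  is_least_concave_majorant a b G H ->
  (forall s t, s \in `[a, b] -> t \in `[a, b] ->
    F s - F t <= f t * (s - t) - c * (s - t) ^+ 2) ->
  (forall t, t \in `[a, b] -> `|G t - F t - B t| <= q) ->
  (forall s t, s \in `[a, b] -> t \in `[a, b] -> `|B s - B t| <= c * (s - t) ^+ 2 + r) ->
  forall t, t \in `[a, b] -> `|H t - G t| <= r + 2 * q.
Proof.
move=> c0 lcmH Fc Gq Br; apply: (lcm_diff_le (m := f) lcmH) => s t sab tab.
have := Fc s t sab tab; have := Br s t sab tab.
have := Gq s sab; have := Gq t tab; rewrite !ler_norml.
lra.
Qed.

Lemma lcm_estimator_rate (a b : R) (f df F L dL : R -> R) : a < b ->
  {in `[a, b] &, {homo f : x y /~ x <= y}} ->
  is_derivative_on a b f df ->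
  (0 < inf_on a b (fun t => `|df t|%R))%E ->
  (forall t, t \in `[a, b] -> F t = \int[lebesgue_measure]_(x in `[a, t]) f x) ->
  {in `[a, b] &, {homo L : x y / x <= y}} ->
  is_derivative_on a b L dL -> (sup_on a b dL < +oo)%E ->
  forall (d : measure_display) (T : measurableType d) (P : probability T R)
    (B : nat -> R -> T -> R),
  (forall n, brownian_motion_on P (L a) (L b) (B n) \/
     brownian_bridge_on P (L a) (L b) (B n)) ->
  forall (Fn : nat -> R -> T -> R) (gamma : nat -> R),
  (forall n, 0 < gamma n) ->
  gamma =O_\oo (fun n => (n%:R^-1 * ln n%:R) `^ (2 / 3)) ->
  bounded_in_probability P
     (fun n w => sup_on a b (fun t =>
        `|Fn n t w - F t - n%:R `^ (- (1 / 2)) * B n (L t) w|)) gamma ->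
  forall (Fhat : nat -> R -> T -> R),
  (forall n w, is_least_concave_majorant a b (fun t => Fn n t w) (fun t => Fhat n t w)) ->
  forall e : R, 0 < e -> exists2 C : R, 0 <= C & \forall n \near \oo,
    exists A : set T, [/\ measurable A, (P A <= e%:E)%E & forall w, ~ A w ->
      forall t, t \in `[a, b] -> `|Fhat n t w - Fn n t w| <=
        C * (n%:R `^ (- (2 / 3)) * ln n%:R `^ (2 / 3))].
Proof.
move=> ab f_decr fdf df_inf F_def L_incr LdL dL_sup d T P B B_brownian Fn gamma
  gamma_gt0 gamma_rate Fn_approx Fhat Fhat_lcm e e0.
have [c c0 dfc] := inf_on_gt0 (ltW ab) df_inf.
have [m dLm] := sup_on_lty (ltW ab) dL_sup.
have dLm1 t : t \in `[a, b] -> dL t <= `|m|.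
  by move=> /dLm /le_trans; apply; exact: ler_norm.
have Fconc := strongly_concave_primitive (strongly_decreasing ab fdf f_decr dfc c0)
  (integral_decreasing_bounds (is_derivative_on_continuous fdf) f_decr F_def).
(* [strongly_decreasing] leaves [c / 2], of which [strongly_concave_primitive] keeps a
   quarter *)
have c80 : 0 < c / 2 / 4 by rewrite !divr_gt0.
(* half of [e] is for the approximation of the estimator, half for the modulus *)
have e20 : 0 < e / 2 by rewrite divr_gt0.
have [C0 C00 HB] := time_changed_brownian_modulus ab LdL L_incr dLm1 (normr_ge0 m) e20 c80.
have [k k0 Hgamma] : exists2 k : R, 0 <= k & \forall n \near \oo,
    gamma n <= k * (n%:R^-1 * ln n%:R) `^ (2 / 3).
  move/eqOP : gamma_rate => [k0 [_ Hk]].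
  exists (`|k0| + 1); first by rewrite addr_ge0.
  have kk : k0 < `|k0| + 1 by rewrite (le_lt_trans (ler_norm _))// ltrDl.
  apply: filterS (Hk _ kk) => n; rewrite (ger0_norm (powR_ge0 _ _)).
  by apply: le_trans; exact: ler_norm.
have [M HM] := Fn_approx _ e20.
exists (C0 + 2 * (`|M| * k)); first by rewrite addr_ge0 ?mulr_ge0.
near=> n.
have n4 : (4 <= n)%N by near: n; exact: nbhs_infty_ge.
have gn : gamma n <= k * (n%:R^-1 * ln n%:R) `^ (2 / 3) by near: n.
have [A1 [mA1 PA1 HA1]] : exists A : set T, [/\ measurable A, (P A <= (e / 2)%:E)%E &
    forall w, ~ A w -> (`|sup_on a b (fun t =>
      `|Fn n t w - F t - n%:R `^ (- (1 / 2)) * B n (L t) w|%R)| <= (M * gamma n)%:E)%E].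
  by near: n.
have [eta eta0 [eta3 eta2 eta2']] := eta_rate (R := R) n4.
have [A2 [mA2 PA2 HA2]] := HB d T P (B n) (B_brownian n) n eta n4 eta0 eta3.
exists (A1 `|` A2); split; first exact: measurableU.
  apply: (@le_trans _ _ (P A1 + P A2)%E); first exact: measureU2.
  by rewrite [e in e%:E](splitr e) EFinD leeD.
move=> w /not_orP[nA1 nA2] t tab.
have Gq s : s \in `[a, b] -> `|Fn n s w - F s - n%:R `^ (- (1 / 2)) * B n (L s) w| <=
    `|M| * k * eta ^+ 2.
  move=> sab; apply: (le_trans (abs_sup_on_le (HA1 w nA1) sab)).
  apply: (@le_trans _ _ (`|M| * gamma n)); first by rewrite ler_wpM2r ?ler_norm// ltW.
  by rewrite -mulrA eta2 ler_wpM2l.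
have Br s u : s \in `[a, b] -> u \in `[a, b] ->
    `|n%:R `^ (- (1 / 2)) * B n (L s) w - n%:R `^ (- (1 / 2)) * B n (L u) w| <=
    c / 2 / 4 * (s - u) ^+ 2 + C0 * eta ^+ 2.
  move=> sab uab; rewrite -mulrBr normrM (ger0_norm (powR_ge0 _ _)).
  exact: HA2.
apply: (le_trans (lcm_close_of_noise c80 (Fhat_lcm n w) Fconc Gq Br tab)).
by rewrite -eta2' [leRHS]mulrDl !mulrA.
Unshelve. all: by end_near.
Qed.

End majorant_rate.

(** [K'] vanishes where [`|u| > 1] because [K] does so nearby, and at [1] and [-1] by
    continuity: [K] and [K'] are both of bounded variation and supported on [[-1, 1]]. *)
Lemma kernel_smoothing_bound {R : realType} (K : R -> R) :
  (forall t, 1 < `|t| -> K t = 0) ->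
  (forall t : R, derivable K t 1) -> (forall t : R, derivable (derive1 K) t 1) ->
  lebesgue_measure.-integrable setT (EFin \o derive1 K) ->
  lebesgue_measure.-integrable setT (EFin \o derive1n 2 K) ->
  exists v : R, forall (a b h Delta t : R) (G H : R -> R),
    0 < h -> 2 * h <= b - a ->
    stieltjes_decomposable a b G -> stieltjes_decomposable a b H ->
    0 <= Delta -> (forall x, x \in `[a, b] -> `|G x - H x| <= Delta) -> t \in `[a, b] ->
    forall l, (l <= 1)%N ->
    `|derive1n l (corrected_kernel_estimator a b K h G) t -
      derive1n l (corrected_kernel_estimator a b K h H) t| <= v * h ^- (1 + l) * Delta.
Proof.
move=> K_support K_derivable dK_derivable dK_integrable ddK_integrable.
have cont (k : R -> R) : (forall t : R, derivable k t 1) -> continuous k.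
  by move=> dk t; apply: differentiable_continuous; apply/derivable1_diffP; exact: dk.
have KdK u : is_derive u (1 : R) K (derive1 K u) by rewrite derive1E; exact/derivableP.
have dKddK u : is_derive u (1 : R) (derive1 K) (derive1n 2 K u).
  by rewrite /= derive1E; exact/derivableP.
have K0 := vanish_at_boundary (cont _ K_derivable) K_support.
have dK0 : forall u, 1 <= `|u| -> derive1 K u = 0.
  apply: vanish_at_boundary; first exact: cont.
  move=> u u1; rewrite derive1E; apply: (@derive_val _ _ _ _ _ K 0).
  apply/is_derive_linear_approx => e e0; exists (`|u| - 1); first by rewrite subr_gt0.
  move=> x xu; rewrite !K_support//.
    by rewrite subrr mul0r subrr normr0 mulr_ge0// ltW.
  have := ler_normB u (u - x); rewrite subKr (distrC u).
  have := lerB_dist u x; rewrite (distrC u); lra.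
have [V0 [v0 [domV0 V0v0]]] := compact_support_dominated KdK dK_integrable K0.
have [V1 [v1 [domV1 V1v1]]] := compact_support_dominated dKddK ddK_integrable dK0.
exists (v0 + v1).
move=> a b h Delta t G H h0 hab [G1 [G2 GE]] [H1 [H2 HE]] D0 GH tab.
have [E0 E1] := corrected_estimator_diff_le h0 hab KdK (cont _ dK_derivable) domV0 V0v0
  domV1 V1v1 K0 dK0 GE HE D0 GH tab.
case=> [_|[_|//]].
  by rewrite derive1n0 expr1 (mulrC (v0 + v1)).
by rewrite derive1n1 (mulrC (v0 + v1)).
Qed.

Theorem lemma4p2 (R : realType) (a b : R) (hab : a < b)
  (f df F : R -> R)
  (f_decr : {in `[a, b] &, {homo f : x y /~ x <= y}})
  (f_C1 : is_C1_on a b f df)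
  (df_inf : (0 < inf_on a b (fun t => `|df t|%R))%E)
  (df_sup : (sup_on a b (fun t => `|df t|%R) < +oo)%E)
  (F_def : forall t, t \in `[a, b] ->
     F t = \int[lebesgue_measure]_(x in `[a, t]) f x)
  (L dL : R -> R)
  (L_incr : {in `[a, b] &, {homo L : x y / x <= y}})
  (L_C1 : is_C1_on a b L dL)
  (dL_inf : (0 < inf_on a b dL)%E)
  (dL_sup : (sup_on a b dL < +oo)%E)
  (d : measure_display) (T : measurableType d) (P : probability T R)
  (B : nat -> R -> T -> R)
  (B_brownian : forall n,
     brownian_motion_on P (L a) (L b) (B n) \/
     brownian_bridge_on P (L a) (L b) (B n))
  (Fn : nat -> R -> T -> R)
  (Fn_measurable : forall n t, t \in `[a, b] -> measurable_fun setT (Fn n t))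
  (Fn_step : forall n w, cadlag_step_on a b (fun t => Fn n t w))
  (gamma : nat -> R)
  (gamma_gt0 : forall n, 0 < gamma n)
  (gamma_rate : gamma =O_\oo (fun n => (n%:R^-1 * ln n%:R) `^ (2 / 3)))
  (Fn_approx : bounded_in_probability P
     (fun n w => sup_on a b (fun t =>
        `|Fn n t w - F t - n%:R `^ (- (1 / 2)) * B n (L t) w|))
     gamma)
  (Fhat : nat -> R -> T -> R)
  (Fhat_lcm : forall n w, is_least_concave_majorant a b
     (fun t => Fn n t w) (fun t => Fhat n t w))
  (K : R -> R)
  (K_ge0 : forall t, 0 <= K t)
  (K_integral : (\int[lebesgue_measure]_t (K t)%:E = 1)%E)
  (K_support : forall t, 1 < `|t| -> K t = 0)
  (K_derivable : forall t : R, derivable K t 1)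
  (dK_derivable : forall t : R, derivable (derive1 K) t 1)
  (dK_integrable : lebesgue_measure.-integrable setT (EFin \o derive1 K))
  (ddK_integrable : lebesgue_measure.-integrable setT (EFin \o derive1n 2 K))
  (h : nat -> R)
  (h_gt0 : forall n, 0 < h n)
  (h_le : forall n, 2 * h n <= b - a)
  (l : nat) (hl : (l <= 1)%N) :
  let ftilde n w := corrected_kernel_estimator a b K (h n) (fun t => Fn n t w) in
  let fhat n w := corrected_kernel_estimator a b K (h n) (fun t => Fhat n t w) in
  bounded_in_probability P
    (fun n w => sup_on a b (fun t => `|derive1n l (fhat n w) t - derive1n l (ftilde n w) t|))
    (fun n => h n ^- (1 + l) * n%:R `^ (- (2 / 3)) * ln n%:R `^ (2 / 3)).
Proof.
move=> ftilde fhat e e0.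
have [v smoothing] := kernel_smoothing_bound K_support K_derivable dK_derivable
  dK_integrable ddK_integrable.
have [C C0 close] := lcm_estimator_rate hab f_decr f_C1.1 df_inf F_def L_incr L_C1.1 dL_sup
  B_brownian gamma_gt0 gamma_rate Fn_approx Fhat_lcm e0.
exists (v * C); apply: filterS close => n [A [mA PA HA]]; exists A; split => // w nA.
apply: le_abs_sup_on; first exact: ltW.
move=> t tab; rewrite normr_ge0/=.
have step := Fn_step n w.
have := smoothing a b (h n) _ t _ _ (h_gt0 n) (h_le n)
  (lcm_step_decomposable hab step (Fhat_lcm n w)) (cadlag_step_decomposable step)
  (mulr_ge0 C0 (mulr_ge0 (powR_ge0 _ _) (powR_ge0 _ _))) (HA w nA) tab l hl.
move=> /le_trans; apply; rewrite le_eqVlt; apply/orP; left; apply/eqP; ring.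
Qed.
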